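(* Let $N,L\ge1$, let $\Phi\in\mathbb{R}^{N\times L}$ be a known matrix, $\sigma^2>0$ known, and $\nu,\lambda>0$. Let $y=\Phi x+n$, where $n\sim\mathcal{N}(0,\sigma^2I_N)$ is independent of the random vector $x\in\mathbb{R}^L$, and $x$ has the Student-$t$ density $$p_X(x)=\left(\frac{\Gamma((\nu+1)/2)}{\Gamma(\nu/2)}\right)^L\left(\frac{\lambda}{\pi\nu}\right)^{L/2}\prod_{i=1}^L\left(1+\frac{\lambda x_i^2}{\nu}\right)^{-\frac{\nu+1}{2}},\qquad x\in\mathbb{R}^L.$$ Then the information matrix $\mathbf{M}^x$ for $\theta=x$ is $$\mathbf{M}^{x}=\frac{\Phi^T\Phi}{\sigma^2}+\frac{\lambda(\nu+1)}{\nu+3}I_{L},$$ and for every estimator $\hat x(y)$ of $x$ whose MSE matrix exists, $\mathbf{E}^{x}\succeq(\mathbf{M}^{x})^{-1}$.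
   Context: $A\succeq B$ means $A-B$ is positive semidefinite. Let $p(y,x)=p(y|x)p_X(x)$ be the joint density of $(y,x)$. The information matrix is $\mathbf{M}^x=-\mathbb{E}_{Y,X}[\nabla_x\nabla_x^T\log p(y,x)]$. For a measurable estimator $\hat x:\mathbb{R}^N\to\mathbb{R}^L$, the MSE matrix is $\mathbf{E}^x=\mathbb{E}_{Y,X}[(x-\hat x(y))(x-\hat x(y))^T]$; it exists if all its entries are finite, i.e. $\mathbb{E}_{Y,X}\|x-\hat x(y)\|^2<\infty$. *)

(* Defs.v *)
From HB Require Import structures.
From mathcomp Require Import all_boot all_order all_algebra.
From mathcomp Require Import all_classical all_reals all_analysis.
From mathcomp Require Import measurable_realfun.

Set Implicit Arguments.
Unset Strict Implicit.
Unset Printing Implicit Defensive.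

Import Order.TTheory GRing.Theory Num.Theory.
Import numFieldNormedType.Exports.

Local Open Scope classical_set_scope.
Local Open Scope ring_scope.

Definition measure_matrix_display : measure_display -> measure_display.
Proof. exact. Qed.

Section measurable_matrix.
Context {d} {T : measurableType d} {m n : nat}.

(* For T = R this is the Borel sigma-algebra of R^(m x n), presented as the
   smallest one making all the entries measurable. *)
Definition matrix_measurable : set (set 'M[T]_(m, n)) :=
  <<s [set (fun A : 'M[T]_(m, n) => A ij.1 ij.2) @^-1` B |
        ij in [set: 'I_m * 'I_n] & B in measurable] >>.

Let matrix_set0 : matrix_measurable set0.
Proof. exact: sigma_algebra0. Qed.

Let matrix_setC A : matrix_measurable A -> matrix_measurable (~` A).
Proof. exact: sigma_algebraC. Qed.

Let matrix_bigcup (F : (set 'M[T]_(m, n))^nat) :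
  (forall i, matrix_measurable (F i)) -> matrix_measurable (\bigcup_i (F i)).
Proof. exact: sigma_algebra_bigcup. Qed.

HB.instance Definition _ := @isMeasurable.Build (measure_matrix_display d)
  'M[T]_(m, n) matrix_measurable matrix_set0 matrix_setC matrix_bigcup.

Lemma measurable_entry (i : 'I_m) (j : 'I_n) :
  measurable_fun [set: 'M[T]_(m, n)] (fun A => A i j).
Proof.
move=> _ B mB; rewrite setTI; apply: sub_sigma_algebra.
by exists (i, j) => //; exists B.
Qed.

Lemma measurable_fun_entryP d' (U : measurableType d') (f : U -> 'M[T]_(m, n)) :
  measurable_fun setT f <->
  forall i j, measurable_fun setT (fun u => f u i j).
Proof.
split=> [mf i j|mf].
  exact: (measurableT_comp (measurable_entry i j) mf).
move=> _ A mA; rewrite setTI.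
have : image_set_system setT f measurable A.
  move: A mA; apply: smallest_sub.
    exact/sigma_algebra_image/sigma_algebra_measurable.
  move=> _ [[i j] _ [B mB <-]].
  by have := mf i j measurableT B mB.
by rewrite /image_set_system /= setTI.
Qed.

End measurable_matrix.

Section lebesgue_vec.
Context {R : realType}.

Definition vcons n (av : measurableTypeR R * 'cV[R]_n) : 'cV[R]_n.+1 :=
  \col_i (if unlift ord0 i is Some k then av.2 k ord0 else av.1).

Definition vuncons n (v : 'cV[R]_n.+1) : measurableTypeR R * 'cV[R]_n :=
  (v ord0 ord0, \col_i v (lift ord0 i) ord0).

Lemma vconsK n : cancel (@vcons n) (@vuncons n).
Proof.
move=> [a v]; rewrite /vuncons /vcons mxE unlift_none; congr pair.
by apply/colP => i; rewrite !mxE liftK.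
Qed.

Lemma vunconsK n : cancel (@vuncons n) (@vcons n).
Proof.
by move=> v; apply/colP => i; rewrite mxE; case: unliftP => [k|] -> //=;
  rewrite mxE.
Qed.

Lemma measurable_vcons n : measurable_fun setT (@vcons n).
Proof.
apply/measurable_fun_entryP => i j.
under eq_fun do rewrite mxE.
case: (unlift ord0 i) => [k|]; last exact: measurable_fst.
exact: (measurableT_comp (measurable_entry k ord0) measurable_snd).
Qed.

Lemma measurable_vuncons n : measurable_fun setT (@vuncons n).
Proof.
apply/measurable_fun_pair; first exact: measurable_entry.
apply/measurable_fun_entryP => i j.
by under eq_fun do rewrite mxE; exact: measurable_entry.
Qed.

HB.instance Definition _ n :=
  isMeasurableFun.Build _ _ _ _ (@vcons n) (@measurable_vcons n).

Section lebesgue_vecS.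
Context {n : nat} (mu : {sigma_finite_measure set 'cV[R]_n -> \bar R}).

Definition lebesgue_vecS : set 'cV[R]_n.+1 -> \bar R :=
  pushforward (lebesgue_measure \x mu)%E (@vcons n).

Let lebesgue_vecS0 : lebesgue_vecS set0 = 0%E.
Proof. exact: measure0. Qed.

Let lebesgue_vecS_ge0 A : (0 <= lebesgue_vecS A)%E.
Proof. exact: measure_ge0. Qed.

Let lebesgue_vecS_sigma_additive : semi_sigma_additive lebesgue_vecS.
Proof. exact: measure_semi_sigma_additive. Qed.

HB.instance Definition _ := isMeasure.Build _ _ _ lebesgue_vecS
  lebesgue_vecS0 lebesgue_vecS_ge0 lebesgue_vecS_sigma_additive.

Lemma lebesgue_vecSE (A : set R) (B : set 'cV[R]_n) :
  measurable A -> measurable B ->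
  lebesgue_vecS (@vuncons n @^-1` (A `*` B)) = (lebesgue_measure A * mu B)%E.
Proof.
move=> mA mB; rewrite /lebesgue_vecS /pushforward -comp_preimage.
rewrite (_ : _ \o _ = id) ?preimage_id; last exact/funext/vconsK.
exact: product_measure1E.
Qed.

Let lebesgue_vecS_sigma_finite : sigma_finite setT lebesgue_vecS.
Proof.
have /sigma_finiteP[F [TF ndF Foo]] := sigma_finiteT (@lebesgue_measure R).
have /sigma_finiteP[G [TG ndG Goo]] := sigma_finiteT mu.
exists (fun k => @vuncons n @^-1` (F k `*` G k)).
  apply/esym; rewrite -subTset => v _.
  have [k _ Fk] : (\bigcup_k F k) (vuncons v).1 by rewrite -TF.
  have [l _ Gl] : (\bigcup_k G k) (vuncons v).2 by rewrite -TG.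
  exists (maxn k l) => //; split.
  - by move: Fk; exact/subsetPset/ndF/leq_maxl.
  - by move: Gl; exact/subsetPset/ndG/leq_maxr.
move=> k; have [mF Fk] := Foo k; have [mG Gk] := Goo k; split.
  rewrite -[X in measurable X]setTI; apply: measurable_vuncons => //.
  exact: measurableX.
by rewrite lebesgue_vecSE// lte_mul_pinfty// ge0_fin_numE.
Qed.

HB.instance Definition _ := Measure_isSigmaFinite.Build _ _ _ lebesgue_vecS
  lebesgue_vecS_sigma_finite.

End lebesgue_vecS.

(* The Lebesgue measure on R^n, as the n-fold product of the Lebesgue measure
   on R; R^0 is a single point of mass 1. *)
Fixpoint lebesgue_vec (n : nat) : {sigma_finite_measure set 'cV[R]_n -> \bar R} :=
  if n is k.+1 then lebesgue_vecS (lebesgue_vec k) else \d_(0 : 'cV[R]_0).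

End lebesgue_vec.
Arguments lebesgue_vec R n : clear implicits.


Lemma measurable_box (R : realType) (n : nat) (A : 'I_n -> set R) :
  (forall i, measurable (A i)) ->
  measurable [set v : 'cV[R]_n | forall i, A i (v i ord0)].
Proof.
move=> mA; rewrite (_ : [set v | _] = \bigcap_(i in [set: 'I_n])
    ((fun v : 'cV[R]_n => v i ord0) @^-1` A i)).
  apply: fin_bigcap_measurable => // i _.
  by rewrite -[X in measurable X]setTI; exact: measurable_entry.
by apply/seteqP; split=> v /= Av i; [move=> _|]; exact: Av.
Qed.

Lemma lebesgue_vec_box (R : realType) (n : nat) (A : 'I_n -> set R) :
  (forall i, measurable (A i)) ->
  lebesgue_vec R n [set v | forall i, A i (v i ord0)] =
  (\prod_(i < n) lebesgue_measure (A i : set (measurableTypeR R)))%E.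
Proof.
elim: n A => [|n IH] A mA.
  by rewrite big_ord0 /= diracE mem_set// => -[].
rewrite big_ord_recl -IH// [lebesgue_vec R n.+1]/= -lebesgue_vecSE//.
- congr (lebesgue_vecS _ _); apply/seteqP; split=> v /=.
    by move=> Av; split=> [|i] /=; rewrite ?mxE; exact: Av.
  move=> [A0 Av] i; case: (unliftP ord0 i) => [k|] -> //.
  by have := Av k; rewrite mxE.
- exact: (@measurable_box _ _ (fun i => A (lift ord0 i))).
Qed.

Definition hessian {R : realType} {n : nat} (f : 'cV[R]_n -> R) (x : 'cV[R]_n)
    : 'M[R]_n :=
  \matrix_(i, j) 'D_(delta_mx i ord0) ('D_(delta_mx j ord0) f) x.

Definition possemidef {R : realType} {n : nat} (A : 'M[R]_n) :=
  A^T = A /\ forall v : 'cV[R]_n, 0 <= (v^T *m A *m v) ord0 ord0.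

Definition loewner_ge {R : realType} {n : nat} (A B : 'M[R]_n) :=
  possemidef (A - B).

(* Euler's integral, for s > 0. *)
Definition Gamma {R : realType} (s : R) : R :=
  fine (\int[lebesgue_measure]_(t in `]0, +oo[) (t `^ (s - 1) * expR (- t))%:E).

(* For an invertible covariance matrix S. *)
Definition mvnormal_pdf {R : realType} {n : nat} (m : 'cV[R]_n) (S : 'M[R]_n)
    (v : 'cV[R]_n) : R :=
  (Num.sqrt ((2 * pi) ^+ n * \det S))^-1 *
  expR (- ((v - m)^T *m invmx S *m (v - m)) ord0 ord0 / 2).

Definition student_pdf {R : realType} (L : nat) (nu lambda : R) (x : 'cV[R]_L) :
    R :=
  (Gamma ((nu + 1) / 2) / Gamma (nu / 2)) ^+ L *
  (lambda / (pi * nu)) `^ (L%:R / 2) *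
  \prod_(i < L) (1 + lambda * x i ord0 ^+ 2 / nu) `^ (- ((nu + 1) / 2)).

(* p(y, x) = p(y | x) p_X(x): since y = Phi x + n with n ~ N(0, sigma2 I)
   independent of x, p(. | x) is the N(Phi x, sigma2 I) density. Lemma joint_pdfP
   below shows that this is indeed a density of (y, x). *)
Definition joint_pdf {R : realType} {N L : nat} (Phi : 'M[R]_(N, L))
    (sigma2 nu lambda : R) (y : 'cV[R]_N) (x : 'cV[R]_L) : R :=
  mvnormal_pdf (Phi *m x) sigma2%:M y * student_pdf nu lambda x.

Section random_vectors.
Context {d : measure_display} {Omega : measurableType d} {R : realType}.
Variable P : probability Omega R.

Definition independent_rv d1 d2 (T1 : measurableType d1)
    (T2 : measurableType d2) (X : {RV P >-> T1}) (Y : {RV P >-> T2}) :=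
  forall A B, measurable A -> measurable B ->
    P (X @^-1` A `&` Y @^-1` B) = (P (X @^-1` A) * P (Y @^-1` B))%E.

Definition has_density n (X : {RV P >-> 'cV[R]_n}) (f : 'cV[R]_n -> R) :=
  forall A, measurable A ->
    distribution P X A = (\int[lebesgue_vec R n]_(v in A) (f v)%:E)%E.

(* The matrix -E[grad_x grad_x^T log p(Y, X)]. *)
Definition information_matrix N L (p : 'cV[R]_N -> 'cV[R]_L -> R)
    (Y : {RV P >-> 'cV[R]_N}) (X : {RV P >-> 'cV[R]_L}) : 'M[R]_L :=
  - \matrix_(i, j) fine
      'E_P[fun w => hessian (fun x => ln (p (Y w) x)) (X w) i j].

Definition estimation_error N L (xhat : {mfun 'cV[R]_N >-> 'cV[R]_L})
    (Y : {RV P >-> 'cV[R]_N}) (X : {RV P >-> 'cV[R]_L}) (w : Omega) :=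
  X w - xhat (Y w).

(* All the entries of the MSE matrix are well defined and finite. *)
Definition mse_exists N L (xhat : {mfun 'cV[R]_N >-> 'cV[R]_L})
    (Y : {RV P >-> 'cV[R]_N}) (X : {RV P >-> 'cV[R]_L}) :=
  forall i j : 'I_L, P.-integrable setT (EFin \o (fun w =>
    let e := estimation_error xhat Y X w in (e *m e^T) i j)).

Definition mse_matrix N L (xhat : {mfun 'cV[R]_N >-> 'cV[R]_L})
    (Y : {RV P >-> 'cV[R]_N}) (X : {RV P >-> 'cV[R]_L}) : 'M[R]_L :=
  \matrix_(i, j) fine 'E_P[fun w =>
    let e := estimation_error xhat Y X w in (e *m e^T) i j].

End random_vectors.

Section translation.
Context {R : realType}.

Lemma lebesgue_measure_shift (c : R) (A : set (measurableTypeR R)) :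
  measurable A ->
  lebesgue_measure ((fun t : measurableTypeR R => (t : R) + c) @^-1` A) =
  lebesgue_measure A.
Proof.
move=> mA.
pose s : measurableTypeR R -> measurableTypeR R := fun t => (t : R) + c.
have ms : measurable_fun setT s by exact: (@measurable_funD _ (measurableTypeR R) R setT id (cst c)).
pose sM := isMeasurableFun.Build _ _ _ _ s ms.
pose S : {mfun measurableTypeR R >-> measurableTypeR R} := HB.pack s sM.
rewrite -[LHS]/(pushforward lebesgue_measure S A).
apply/esym; apply: lebesgue_measure_unique => // _ [[a b] _ <-].
have E : s @^-1` `]a, b]%classic = `]a - c, b - c]%classic.
  by apply/seteqP; split=> t; rewrite /s /= !in_itv/= ltrBlDr lerBrDr.
rewrite /pushforward /=.
rewrite -[RHS]/(lebesgue_measure (s @^-1` `]a, b]%classic)) E !lebesgue_measure_itv/= !lte_fin ltrD2r.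
by case: ifPn => // _; rewrite -!EFinB opprB addrA subrK.
Qed.

Lemma measurable_addv n (a : 'cV[R]_n) :
  measurable_fun setT (fun v : 'cV[R]_n => v + a).
Proof.
apply/measurable_fun_entryP => i j; under eq_fun do rewrite mxE.
by apply: measurable_funD => //; exact: measurable_entry.
Qed.

Lemma lebesgue_vec_shift n (a : 'cV[R]_n) (A : set 'cV[R]_n) : measurable A ->
  lebesgue_vec R n ((fun v => v + a) @^-1` A) = lebesgue_vec R n A.
Proof.
elim: n a A => [|n IH] a A mA.
  congr (lebesgue_vec R 0 _).
  by apply/seteqP; split=> v /=; rewrite (_ : v + a = v)//; apply/colP => -[].
pose s (z : measurableTypeR R * 'cV[R]_n) : measurableTypeR R * 'cV[R]_n :=
  ((z.1 : R) + a ord0 ord0, z.2 + (vuncons a).2).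
have ms : measurable_fun setT s.
  apply/measurable_fun_pair.
    by apply: (@measurable_funD _ (measurableTypeR R * _)%type R setT fst (cst _)) => //; exact: measurable_fst.
  exact: (measurableT_comp (measurable_addv (vuncons a).2) measurable_snd).
pose sM := isMeasurableFun.Build _ _ _ _ s ms.
pose S : {mfun (measurableTypeR R * 'cV[R]_n)%type >-> (measurableTypeR R * 'cV[R]_n)%type} :=
  HB.pack s sM.
rewrite /= /lebesgue_vecS /pushforward.
have mB : measurable (@vcons R n @^-1` A).
  by rewrite -[X in measurable X]setTI; exact: measurable_vcons.
rewrite [RHS](@product_measure_unique _ _ _ _ _ _ _
    (pushforward (lebesgue_measure \x lebesgue_vec R n)%E S))//.
  have E : @vcons R n \o s = (fun v => v + a) \o @vcons R n.
    apply/funext => z; apply/colP => i; rewrite !mxE/=.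
    by case: (unliftP ord0 i) => [k|] -> //=; rewrite !mxE.
  by rewrite /pushforward -comp_preimage -E comp_preimage.
move=> B C mB' mC.
rewrite -[LHS]/((lebesgue_measure \x lebesgue_vec R n)%E
  (((fun t : measurableTypeR R => (t : R) + a ord0 ord0) @^-1` B) `*`
   ((fun v => v + (vuncons a).2) @^-1` C))).
rewrite product_measure1E//.
- by congr (_ * _)%E; [exact: lebesgue_measure_shift|exact: IH].
- rewrite -[X in measurable X]setTI.
  exact: (@measurable_funD _ (measurableTypeR R) R setT id (cst (a ord0 ord0))).
- by rewrite -[X in measurable X]setTI; exact: measurable_addv.
Qed.

Lemma ge0_integral_shift n (a : 'cV[R]_n) (f : 'cV[R]_n -> \bar R) :
  measurable_fun setT f -> (forall v, (0 <= f v)%E) ->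
  (\int[lebesgue_vec R n]_v f (v + a)%R = \int[lebesgue_vec R n]_v f v)%E.
Proof.
move=> mf f0.
pose sM := isMeasurableFun.Build _ _ _ _ _ (measurable_addv a).
pose S : {mfun 'cV[R]_n >-> 'cV[R]_n} := HB.pack (fun v : 'cV[R]_n => v + a) sM.
transitivity (\int[pushforward (lebesgue_vec R n) S]_v f v)%E.
  by rewrite ge0_integral_pushforward.
apply: eq_measure_integral => A mA _; exact: lebesgue_vec_shift.
Qed.

End translation.

Section additive_noise.
Context {d : measure_display} {Omega : measurableType d} {R : realType}.
Variable P : probability Omega R.

Lemma measurable_mulmxl m n (A : 'M[R]_(m, n)) :
  measurable_fun setT (fun v : 'cV[R]_n => A *m v).
Proof.
apply/measurable_fun_entryP => i j; under eq_fun do rewrite mxE.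
apply: measurable_sum => k.
by apply: measurable_funM => //; exact: measurable_entry.
Qed.

Lemma additive_noise_density N L (Phi : 'M[R]_(N, L))
    (X : {RV P >-> 'cV[R]_L}) (n Y : {RV P >-> 'cV[R]_N})
    (f : 'cV[R]_L -> R) (g : 'cV[R]_N -> R) :
  measurable_fun setT f -> measurable_fun setT g ->
  (forall x, 0 <= f x) -> (forall v, 0 <= g v) ->
  has_density X f -> has_density n g -> independent_rv n X ->
  (forall w, Y w = Phi *m X w + n w) ->
  forall A : set ('cV[R]_N * 'cV[R]_L), measurable A ->
  P ((fun w => (Y w, X w)) @^-1` A) =
  (\int[lebesgue_vec R N \x lebesgue_vec R L]_(z in A)
     (g (z.1 - Phi *m z.2)%R * f z.2)%:E)%E.
Proof.
move=> mf mg f0 g0 Xf ng indep YE A mA.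
have mf2 : measurable_fun [set: 'cV[R]_N * 'cV[R]_L] (fun z => f z.2).
  exact: (measurableT_comp mf measurable_snd).
have mg1 : measurable_fun [set: 'cV[R]_N * 'cV[R]_L] (fun z => g z.1).
  exact: (measurableT_comp mg measurable_fst).
pose mu := (lebesgue_vec R N \x lebesgue_vec R L)%E.
pose h (z : 'cV[R]_N * 'cV[R]_L) := (g z.1 * f z.2)%:E.
have mh : measurable_fun setT h.
  by apply/measurable_EFinP; exact: measurable_funM.
have h0 z : (0 <= h z)%E by rewrite lee_fin mulr_ge0.
pose nu B := (\int[mu]_(z in B) h z)%E.
have nu0 : nu set0 = 0%E by rewrite /nu integral_set0.
have nu_ge0 B : (0 <= nu B)%E by apply: integral_ge0.
have nu_sig : semi_sigma_additive nu.
  move=> F mF tF mUF; rewrite /nu ge0_integral_bigcup//.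
    by apply: is_cvg_nneseries => k _ _; exact: integral_ge0.
  exact: measurable_funTS.
pose nuM := isMeasure.Build _ _ _ nu nu0 nu_ge0 nu_sig.
pose NU : {measure set ('cV[R]_N * 'cV[R]_L)%type -> \bar R} := HB.pack nu nuM.
pose nx w := (n w, X w).
have mnx : measurable_fun setT nx by apply/measurable_fun_pair.
pose nxM := isMeasurableFun.Build _ _ _ _ nx mnx.
pose NX : {mfun Omega >-> ('cV[R]_N * 'cV[R]_L)%type} := HB.pack nx nxM.
have law C : measurable C -> P (NX @^-1` C) = nu C.
  move=> mC.
  transitivity ((distribution P n \x distribution P X)%E C).
    apply/esym.
    by apply: (@product_measure_unique _ _ _ _ _ _ _ (distribution P NX)).
  apply: (@product_measure_unique _ _ _ _ _ _ _ NU) => // B D mB mD.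
  rewrite /= Xf// ng// /nu.
  rewrite integral_mkcond fubini_tonelli1/=; last 2 first.
  - by apply/(measurable_restrictT _ _).1; [exact: measurableX|exact: measurable_funTS].
  - by move=> z; rewrite erestrict_ge0.
  rewrite /fubini_F [in RHS]integral_mkcond.
  rewrite -ge0_integralZr//.
  - apply: eq_integral => v _ /=.
    rewrite [in RHS]integral_mkcond -ge0_integralZl//.
    + apply: eq_integral => x _; rewrite /patch in_setX/=.
      by case: (v \in B); case: (x \in D); rewrite /= ?mul0e ?mule0 ?EFinM.
    + apply/(measurable_restrictT _ _).1 => //; apply: measurable_funTS.
      exact/measurable_EFinP.
    + by move=> x _; rewrite erestrict_ge0// => y _; rewrite lee_fin.
    + by rewrite erestrict_ge0// => y _; rewrite lee_fin.
  - apply/(measurable_restrictT _ _).1 => //; apply: measurable_funTS.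
    exact/measurable_EFinP.
  - by move=> x _; rewrite erestrict_ge0// => y _; rewrite lee_fin.
  - by apply: integral_ge0 => x _; rewrite lee_fin.
pose s (z : 'cV[R]_N * 'cV[R]_L) := (z.1 + Phi *m z.2, z.2).
have mPhi2 : measurable_fun [set: 'cV[R]_N * 'cV[R]_L] (fun z => Phi *m z.2).
  exact: (measurableT_comp (measurable_mulmxl Phi) measurable_snd).
have madd (b : bool) : measurable_fun [set: 'cV[R]_N * 'cV[R]_L]
    (fun z => z.1 + (-1) ^+ b *: (Phi *m z.2)).
  apply/measurable_fun_entryP => i j; under eq_fun do rewrite 2!mxE.
  apply: measurable_funD.
    exact: (measurableT_comp (measurable_entry i j) measurable_fst).
  apply: measurable_funM => //.
  exact: (measurableT_comp (measurable_entry i j) mPhi2).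
have ms : measurable_fun setT s.
  apply/measurable_fun_pair => //.
  by have := madd false; under eq_fun do rewrite expr0 scale1r.
have mk : measurable_fun setT (fun z : 'cV[R]_N * 'cV[R]_L =>
    (g (z.1 - Phi *m z.2)%R * f z.2)%:E).
  apply/measurable_EFinP; apply: measurable_funM => //.
  apply: (measurableT_comp mg).
  by have := madd true; under eq_fun do rewrite expr1 scaleN1r.
transitivity (P (NX @^-1` (s @^-1` A))).
  congr (P _); apply/seteqP; split=> w /=; rewrite /s /= YE addrC//.
have msA : measurable (s @^-1` A) by rewrite -[X in measurable X]setTI; exact: ms.
rewrite law// /nu integral_mkcond [in RHS]integral_mkcond.
have hA0 z : (0 <= (h \_ (s @^-1` A)) z)%E by rewrite erestrict_ge0.
have mhA : measurable_fun setT (h \_ (s @^-1` A)).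
  by apply/(measurable_restrictT _ _).1; [|exact: measurable_funTS].
set k := (fun z => _) in mk *.
have kA0 z : (0 <= (k \_ A) z)%E.
  by rewrite erestrict_ge0// => y _; rewrite lee_fin mulr_ge0.
have mkA : measurable_fun setT (k \_ A).
  by apply/(measurable_restrictT _ _).1; [|exact: measurable_funTS].
rewrite (@fubini_tonelli2 _ _ _ _ _ _ _ _ mhA hA0).
rewrite (@fubini_tonelli2 _ _ _ _ _ _ _ _ mkA kA0).
apply: eq_integral => x _; rewrite /fubini_G.
rewrite -[RHS](ge0_integral_shift (Phi *m x)).
- by apply: eq_integral => v _; rewrite /patch /k /h /= addrK.
- by apply: (measurableT_comp mkA); exact: pair2_measurable.
- by [].
Qed.

Lemma measurable_mvnormal_pdf N (m : 'cV[R]_N) (S : 'M[R]_N) :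
  measurable_fun setT (mvnormal_pdf m S).
Proof.
apply: measurable_funM => //; apply: measurableT_comp => //.
apply: measurable_funM => //; apply: measurable_funN.
have mB i j : measurable_fun setT (fun v : 'cV[R]_N => (v - m) i j).
  by under eq_fun do rewrite mxE; apply: measurable_funD => //;
    exact: measurable_entry.
under eq_fun do rewrite mxE; apply: measurable_sum => i.
apply: measurable_funM => //; under eq_fun do rewrite mxE.
apply: measurable_sum => j; apply: measurable_funM => //.
by under eq_fun do [rewrite mxE]; exact: mB.
Qed.

Lemma measurable_student_pdf L (nu lambda : R) :
  measurable_fun setT (@student_pdf R L nu lambda).
Proof.
apply: measurable_funM => //; apply: measurable_prod => i _.
apply: (measurableT_comp (measurable_powR _)).
apply: measurable_funD => //; apply: measurable_funM => //.
apply: measurable_funM => //; apply: measurable_funX.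
exact: measurable_entry.
Qed.

Lemma Gamma_ge0 (s : R) : 0 <= Gamma s.
Proof.
apply/fine_ge0/integral_ge0 => t _.
by rewrite lee_fin mulr_ge0 ?powR_ge0 ?expR_ge0.
Qed.

Lemma mvnormal_pdf_ge0 N (m : 'cV[R]_N) (S : 'M[R]_N) v :
  0 <= mvnormal_pdf m S v.
Proof. by rewrite mulr_ge0 ?expR_ge0// invr_ge0 sqrtr_ge0. Qed.

Lemma student_pdf_ge0 L (nu lambda : R) (x : 'cV[R]_L) :
  0 <= student_pdf nu lambda x.
Proof.
rewrite !mulr_ge0 ?powR_ge0 ?exprn_ge0 ?divr_ge0 ?Gamma_ge0//.
by apply: prodr_ge0 => i _; exact: powR_ge0.
Qed.

Lemma joint_pdfP N L (Phi : 'M[R]_(N, L)) (sigma2 nu lambda : R)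
    (x : {RV P >-> 'cV[R]_L}) (n y : {RV P >-> 'cV[R]_N}) :
  has_density x (student_pdf nu lambda) ->
  has_density n (mvnormal_pdf 0 sigma2%:M) -> independent_rv n x ->
  (forall w, y w = Phi *m x w + n w) ->
  forall A : set ('cV[R]_N * 'cV[R]_L), measurable A ->
  P ((fun w => (y w, x w)) @^-1` A) =
  (\int[lebesgue_vec R N \x lebesgue_vec R L]_(z in A)
     (joint_pdf Phi sigma2 nu lambda z.1 z.2)%:E)%E.
Proof.
move=> xf ng indep yE A mA.
rewrite (additive_noise_density (@measurable_student_pdf _ nu lambda)
  (@measurable_mvnormal_pdf _ _ _) (student_pdf_ge0 nu lambda)
  (@mvnormal_pdf_ge0 _ _ _) xf ng indep yE mA).
by apply: eq_integral => z _; rewrite /joint_pdf /mvnormal_pdf subr0.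
Qed.

End additive_noise.

(* Main.v *)
Require Import Defs.
From HB Require Import structures.
From mathcomp Require Import all_boot all_order all_algebra.
From mathcomp Require Import all_classical all_reals all_analysis.
From mathcomp Require Import measurable_realfun ring lra.

Import Order.TTheory GRing.Theory Num.Theory.
Import numFieldNormedType.Exports.

Set Implicit Arguments.
Unset Strict Implicit.
Unset Printing Implicit Defensive.

Local Open Scope classical_set_scope.
Local Open Scope ring_scope.

(** The pair Z = (n, x) has a density C * exp(l) on R^N x R^L whose logarithm is
    smooth and locally Lipschitz.  Translation invariance of Lebesgue measure
    gives, for every direction c and every step h,
      E[F(Z)] = E[F(Z + h c) exp(l(Z + h c) - l(Z))],
    and letting h -> 0 by dominated convergence yields a Stein identity
      E[F(Z) d_c l(Z)] = - E[d_c F(Z)]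
    for square integrable F that is Lipschitz along c.  No boundary terms
    appear, and the normalizing constants are never computed.  Everything
    follows from choices of F.
    - F = x_i / (1 + e x_i^2), for e = lambda / nu and for e -> 0, determines
      the moments of (1 + lambda x_i^2 / nu)^-1 that occur in the information
      matrix M.
    - Let v be a vector, b = M^-1 v, and let c = (- Phi b, b) be the direction
      that moves x by b at fixed y.  With S = d_c l(Z), F = d_c l gives
      E[S^2] = b^T M b = v . b, and F = v . (x - xhat(y)) gives
      E[F S] = - v . b.  The van Trees inequality is then 0 <= E[(F + S)^2]. *)

(** * Integration against a measure given by a density *)

Section density.
Local Open Scope ereal_scope.
Context {d} {T : measurableType d} {R : realType}.
Variables mu nu : {measure set T -> \bar R}.
Variable g : T -> R.
Hypothesis mg : measurable_fun setT g.
Hypothesis g0 : forall z, (0 <= g z)%R.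
Hypothesis nuE : forall A, measurable A -> nu A = \int[mu]_(z in A) (g z)%:E.

Import HBNNSimple.

Let mgE : measurable_fun setT (EFin \o g).
Proof. exact/measurable_EFinP. Qed.

Lemma integral_density_nnsfun (h : {nnsfun T >-> R}) :
  \int[nu]_z (h z)%:E = \int[mu]_z ((h z)%:E * (g z)%:E).
Proof.
have h1 y z : 0 <= (y * \1_(h @^-1` [set y]) z)%:E.
  by rewrite EFinM nnfun_muleindic_ge0.
transitivity (\int[mu]_z
    (\sum_(y \in range h) (y * \1_(h @^-1` [set y]) z)%:E * (g z)%:E)); last first.
  apply: eq_integral => z _.
  rewrite -ge0_mule_fsuml //.
  by rewrite fsumEFin// -(fimfunE h z).
rewrite ge0_integral_fsum//; last 2 first.
  - by move=> y; apply: emeasurable_funM => //; exact/measurable_EFinP/measurable_funM.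
  - by move=> y z _; apply: mule_ge0 => //; rewrite lee_fin.
transitivity (\int[nu]_z
    (\sum_(y \in range h) (y * \1_(h @^-1` [set y]) z)%:E)).
  by apply: eq_integral => z _; rewrite fsumEFin// -(fimfunE h z).
rewrite ge0_integral_fsum//; last by move=> y; exact/measurable_EFinP/measurable_funM.
apply: eq_fsbigr => r; rewrite inE => -[z0 _ rE].
have r0 : (0 <= r)%R by rewrite -rE.
under eq_integral do rewrite EFinM.
under [RHS]eq_integral do rewrite EFinM -muleA.
rewrite !ge0_integralZl//; last 3 first.
- by apply: emeasurable_funM => //; exact/measurable_EFinP.
- by move=> z _; rewrite mule_ge0 ?lee_fin.
- exact/measurable_EFinP.
rewrite integral_indic// setIT nuE// [in LHS]integral_mkcond; congr (_ * _).
apply: eq_integral => z _; rewrite patchE indicE.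
by case: (z \in _); rewrite ?mul1e ?mul0e.
Qed.

(** Monotone convergence extends the case of simple functions, where [nuE] is applied to each level
    set. *)
Lemma ge0_integral_density (F : T -> \bar R) :
  measurable_fun setT F -> (forall z, 0 <= F z) ->
  \int[nu]_z F z = \int[mu]_z (F z * (g z)%:E).
Proof.
move=> mF F0; pose h := nnsfun_approx measurableT mF.
have FE z : F z = lim ((h n z)%:E @[n --> \oo]).
  by apply/esym/cvg_lim => //; exact: (@cvg_nnsfun_approx _ _ _ setT).
have FgE z : F z * (g z)%:E = lim ((h n z)%:E * (g z)%:E @[n --> \oo]).
  apply/esym/cvg_lim => //; apply: cvgeZr => //.
  exact: (@cvg_nnsfun_approx _ _ _ setT).
under eq_integral do rewrite FE.
under [RHS]eq_integral do rewrite FgE.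
rewrite !monotone_convergence//.
- by under eq_fun do rewrite integral_density_nnsfun.
- by move=> n; apply: emeasurable_funM => //; exact/measurable_EFinP.
- by move=> n z _; rewrite mule_ge0 ?lee_fin.
- by move=> z _ a b ab; rewrite lee_wpmul2r ?lee_fin//; exact/lefP/nd_nnsfun_approx.
- by move=> n; exact/measurable_EFinP.
- by move=> n z _; rewrite lee_fin.
- by move=> z _ a b ab; rewrite lee_fin; exact/lefP/nd_nnsfun_approx.
Qed.

End density.

(** * Translation invariance of Lebesgue measure on the product space *)

Section product_shift.
Context {R : realType} {N L : nat}.
Let V := ('cV[R]_N * 'cV[R]_L)%type.

Lemma measurable_shift_pair (c : V) :
  measurable_fun setT (fun z : V => z + c).
Proof.
apply/measurable_fun_pair.
  exact: (measurableT_comp (measurable_addv c.1) measurable_fst).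
exact: (measurableT_comp (measurable_addv c.2) measurable_snd).
Qed.

(** By Tonelli the factors are shifted one at a time: the inner integral absorbs [c.2], the outer
    one [c.1]. *)
Lemma ge0_integral_shift_pair (c : V) (F : V -> \bar R) :
  measurable_fun setT F -> (forall z, 0 <= F z)%E ->
  (\int[lebesgue_vec R N \x lebesgue_vec R L]_z F (z + c)%R =
   \int[lebesgue_vec R N \x lebesgue_vec R L]_z F z)%E.
Proof.
move=> mF F0.
have mFc := measurableT_comp mF (measurable_shift_pair c).
rewrite fubini_tonelli1// [RHS]fubini_tonelli1// /fubini_F /=.
rewrite -[RHS](ge0_integral_shift c.1).
- apply: eq_integral => u _ /=.
  rewrite -[RHS](ge0_integral_shift c.2)//.
  by apply: (measurableT_comp mF); exact: pair1_measurable.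
- exact: measurable_fun_fubini_tonelli_F.
- by move=> u; exact: integral_ge0.
Qed.

End product_shift.

(** * The one-dimensional Student kernel: bounds and derivatives *)

Section student_kernel.
Context {R : realType}.
Implicit Types m t : R.

Definition student_weight m t : R := (1 + m * t ^+ 2)^-1.

Definition student_score m t : R := t / (1 + m * t ^+ 2).

(** This is [(1 - m t^2) / (1 + m t^2)^2], the derivative of [student_score], written as a
    polynomial in the weight: its bound and its mean then involve only a variable with values in (0,
    1]. *)
Definition student_curv m t : R :=
  2 * student_weight m t ^+ 2 - student_weight m t.

Lemma student_den_gt0 m t : 0 < m -> 0 < 1 + m * t ^+ 2.
Proof. by move=> m0; rewrite ltr_pwDl// mulr_ge0 ?sqr_ge0 ?ltW. Qed.

Lemma student_weight_itv m t : 0 < m -> 0 < student_weight m t <= 1.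
Proof.
move=> m0; rewrite invr_gt0 student_den_gt0//= invf_le1 ?student_den_gt0//.
by rewrite lerDl mulr_ge0 ?sqr_ge0 ?ltW.
Qed.

Lemma student_curv_bound m t : 0 < m -> `|student_curv m t| <= 1.
Proof.
move=> m0; rewrite /student_curv; have /andP[] := student_weight_itv t m0.
move: (student_weight m t) => r r0 r1.
by rewrite ler_norml; apply/andP; split; nra.
Qed.

(** Comes from [|t| <= 1 + t^2]. The sharp constant is [1 / (2 sqrt m)], but only uniformity in [t]
    matters. *)
Lemma student_score_bound m t : 0 < m -> `|student_score m t| <= 1 + m^-1.
Proof.
move=> m0; have D0 := student_den_gt0 t m0.
rewrite normrM normfV (gtr0_norm D0) ler_pdivrMr//.
have mV : 0 < m^-1 by rewrite invr_gt0.
have -> : (1 + m^-1) * (1 + m * t ^+ 2) =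
  1 + m^-1 + m * t ^+ 2 + t ^+ 2 by field; rewrite gt_eqF.
have : 0 <= m * t ^+ 2 by rewrite mulr_ge0 ?sqr_ge0 ?ltW.
rewrite -(real_normK (num_real t)); nra.
Qed.

Lemma student_score_diff m t u : 0 < m ->
  student_score m u - student_score m t =
  (u - t) * ((1 - m * t * u) / ((1 + m * t ^+ 2) * (1 + m * u ^+ 2))).
Proof.
move=> m0; have Dt := student_den_gt0 t m0; have Du := student_den_gt0 u m0.
by rewrite /student_score; field; rewrite !gt_eqF.
Qed.

(** The difference quotient is explicit, and [|1 - m t u|] is at most its denominator: expand the
    product and use [m (t + u)^2 >= 0]. *)
Lemma student_score_lipschitz m t u : 0 < m ->
  `|student_score m u - student_score m t| <= `|u - t|.
Proof.
move=> m0; have Dt := student_den_gt0 t m0; have Du := student_den_gt0 u m0.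
rewrite student_score_diff// normrM -[leRHS]mulr1 ler_wpM2l//.
rewrite normrM normfV (gtr0_norm (mulr_gt0 Dt Du)) ler_pdivrMr ?mulr_gt0// mul1r.
have h1 : 0 <= m * (t + u) ^+ 2 by rewrite mulr_ge0 ?sqr_ge0 ?ltW.
rewrite ler_norml; apply/andP; split; nra.
Qed.

Lemma measurable_student_weight m : 0 < m ->
  measurable_fun setT (student_weight m).
Proof.
move=> m0; have -> : student_weight m = (@powR R ^~ (-1)) \o (fun t => 1 + m * t ^+ 2).
  by apply/funext => t /=; rewrite powR_inv1// ltW// student_den_gt0.
apply: (measurableT_comp (measurable_powR _)).
by apply: measurable_funD => //; apply: measurable_funM => //; exact: measurable_funX.
Qed.

Lemma measurable_student_score m : 0 < m ->
  measurable_fun setT (student_score m).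
Proof. by move=> m0; apply: measurable_funM => //; exact: measurable_student_weight. Qed.

Lemma measurable_student_curv m : 0 < m ->
  measurable_fun setT (student_curv m).
Proof.
move=> m0; apply: measurable_funB; last exact: measurable_student_weight.
apply: measurable_funM => //; apply: measurable_funX.
exact: measurable_student_weight.
Qed.

Lemma is_derive_affine (u v : R) :
  is_derive (0 : R) 1 (fun h : R => u + h * v) v.
Proof.
have -> : (fun h : R => u + h * v) = cst u + id * cst v by [].
apply: (is_derive_eq (is_deriveD (is_derive_cst _ _ _)
  (is_deriveM (is_derive_id _ _) (is_derive_cst _ _ _)))).
by rewrite scaler0 !add0r /GRing.scale/= mulr1.
Qed.

Lemma is_derive_quadratic (u v w : R) :
  is_derive (0 : R) 1 (fun h : R => u + h * v + h ^+ 2 * w) v.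
Proof.
have -> : (fun h : R => u + h * v + h ^+ 2 * w) =
    cst u + id * (fun h : R => v + h * w).
  by apply/funext => h; rewrite -addrA expr2 -mulrA -mulrDr.
apply: (is_derive_eq (is_deriveD (is_derive_cst _ _ _)
  (is_deriveM (is_derive_id _ _) (is_derive_affine _ _)))).
by rewrite scale0r !add0r mul0r addr0 /GRing.scale/= mulr1.
Qed.

Let is_derive_den m t b : is_derive (0 : R) 1
  (fun h : R => 1 + m * (t + h * b) ^+ 2) (2 * m * t * b).
Proof.
have -> : (fun h : R => 1 + m * (t + h * b) ^+ 2) = (fun h : R =>
    1 + m * t ^+ 2 + h * (2 * m * t * b) + h ^+ 2 * (m * b ^+ 2)).
  by apply/funext => h; ring.
exact: is_derive_quadratic.
Qed.

Lemma is_derive_student_score m t b : 0 < m ->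
  is_derive (0 : R) 1 (fun h : R => student_score m (t + h * b))
    (b * student_curv m t).
Proof.
move=> m0; have D0 := student_den_gt0 t m0.
have dq := is_derive_den m t b.
have q0 : 1 + m * (t + 0 * b) ^+ 2 != 0 by rewrite mul0r addr0 gt_eqF.
have dV : is_derive (0 : R) 1 (fun h : R => (1 + m * (t + h * b) ^+ 2)^-1)
    (- (1 + m * (t + 0 * b) ^+ 2) ^- 2 * (2 * m * t * b)).
  apply: DeriveDef; first by apply: derivableV => //; exact: ex_derive.
  by rewrite deriveV ?derive_val//; exact: ex_derive.
have -> : (fun h : R => student_score m (t + h * b)) =
  (fun h : R => t + h * b) * (fun h : R => (1 + m * (t + h * b) ^+ 2)^-1) by [].
apply: (is_derive_eq (is_deriveM (is_derive_affine t b) dV)).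
rewrite /GRing.scale/= mul0r addr0 /student_curv /student_weight.
by field; rewrite gt_eqF.
Qed.

Lemma is_derive_student_ln m t b : 0 < m ->
  is_derive (0 : R) 1 (fun h : R => ln (1 + m * (t + h * b) ^+ 2))
    (2 * m * b * student_score m t).
Proof.
move=> m0; have D0 := student_den_gt0 t m0.
have dq := is_derive_den m t b.
have dL : is_derive (1 + m * (t + 0 * b) ^+ 2) 1 (@ln R)
    (1 + m * (t + 0 * b) ^+ 2)^-1.
  by apply: is_derive1_ln; rewrite mul0r addr0.
have dLq : is_derive (0 : R) 1 (fun h : R => ln (1 + m * (t + h * b) ^+ 2))
    ((1 + m * (t + 0 * b) ^+ 2)^-1 * (2 * m * t * b)).
  exact: (@is_derive1_comp R (@ln R) (fun h => 1 + m * (t + h * b) ^+ 2)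
    0 _ _ dL dq).
apply: (is_derive_eq dLq).
by rewrite /student_score mul0r addr0; ring.
Qed.

(** With [q] the ratio of the two arguments, [ln q <= q - 1], and [q - 1] expands exactly around [t]
    into a linear term carrying [student_score] and a quadratic one carrying [student_weight]. Both
    coefficients are bounded in [t], so the bound depends on the increment alone. *)
Lemma ln_student_diff_le m t u : 0 < m ->
  ln (1 + m * u ^+ 2) - ln (1 + m * t ^+ 2) <=
  `|u - t| * (2 * (m + 1) + m * `|u - t|).
Proof.
move=> m0; have Dt := student_den_gt0 t m0; have Du := student_den_gt0 u m0.
rewrite -ln_div ?posrE//.
set q := _ / _.
have -> : q = 1 + (q - 1) by ring.
apply: le_trans (le_ln1Dx _) _.
  by rewrite ltrBrDl subrr divr_gt0.
have -> : q - 1 = (u - t) * (2 * m * student_score m t) +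
    m * (u - t) ^+ 2 * student_weight m t.
  by rewrite /q /student_score /student_weight; field; rewrite gt_eqF.
rewrite mulrDr lerD//.
- rewrite (le_trans (ler_norm _))// normrM ler_wpM2l// normrM.
  have m2 : 0 <= 2 * m by rewrite mulr_ge0 // ltW.
  rewrite ger0_norm//.
  have -> : 2 * (m + 1) = 2 * m * (1 + m^-1) by field; rewrite gt_eqF.
  by rewrite ler_wpM2l// student_score_bound.
- rewrite [leRHS]mulrCA -expr2 real_normK ?num_real//.
  rewrite -[leRHS]mulr1 ler_wpM2l//; first by rewrite mulr_ge0 ?sqr_ge0 ?ltW.
  by have /andP[] := student_weight_itv t m0.
Qed.

Lemma ln_student_diff m t u : 0 < m ->
  `|ln (1 + m * u ^+ 2) - ln (1 + m * t ^+ 2)| <=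
  `|u - t| * (2 * (m + 1) + m * `|u - t|).
Proof.
move=> m0; rewrite ler_norml ln_student_diff_le// andbT lerNl opprB.
by rewrite (le_trans (ln_student_diff_le _ _ _))// distrC.
Qed.

End student_kernel.

(** * The dot product of column vectors *)

Section dot_product.
Context {R : realType} {n : nat}.
Implicit Types u v w : 'cV[R]_n.

Definition dotv u v : R := \sum_i u i ord0 * v i ord0.

Lemma dotvE u v : dotv u v = (u^T *m v) ord0 ord0.
Proof. by rewrite mxE; apply: eq_bigr => i _; rewrite mxE. Qed.

Lemma dotvC u v : dotv u v = dotv v u.
Proof. by apply: eq_bigr => i _; rewrite mulrC. Qed.

Lemma dotvDr u v w : dotv u (v + w) = dotv u v + dotv u w.
Proof. by rewrite -big_split; apply: eq_bigr => i _; rewrite mxE mulrDr. Qed.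

Lemma dotvZr h u v : dotv u (h *: v) = h * dotv u v.
Proof. by rewrite mulr_sumr; apply: eq_bigr => i _; rewrite mxE mulrCA. Qed.

Lemma dotvNr u v : dotv u (- v) = - dotv u v.
Proof. by rewrite -scaleN1r dotvZr mulN1r. Qed.

Lemma dotvNl u v : dotv (- u) v = - dotv u v.
Proof. by rewrite dotvC dotvNr dotvC. Qed.

Lemma dotv_ge0 u : 0 <= dotv u u.
Proof. by apply: sumr_ge0 => i _; rewrite -expr2 sqr_ge0. Qed.

Lemma dotv_eq0 u : dotv u u = 0 -> u = 0.
Proof.
move=> /eqP; rewrite psumr_eq0 => [/allP u0|i _]; last by rewrite -expr2 sqr_ge0.
apply/colP => i; have := u0 i; rewrite mem_index_enum => /(_ erefl).
by rewrite -expr2 sqrf_eq0 mxE => /eqP.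
Qed.

Lemma dotv_delta i v : dotv (delta_mx i ord0) v = v i ord0.
Proof.
rewrite /dotv (bigD1 i)//= mxE !eqxx mul1r big1 ?addr0// => j /negbTE ji.
by rewrite mxE ji mul0r.
Qed.

Lemma dotv_line h u v :
  dotv (u + h *: v) (u + h *: v) = dotv u u + 2 * h * dotv v u + h ^+ 2 * dotv v v.
Proof.
rewrite dotvDr dotvZr (dotvC _ u) (dotvC _ v) !dotvDr !dotvZr (dotvC u v); ring.
Qed.

Lemma measurable_dotv u : measurable_fun setT (dotv u).
Proof.
by apply: measurable_sum => i; apply: measurable_funM => //; exact: measurable_entry.
Qed.

End dot_product.

(** * The logarithm of the density and its derivatives along lines *)

Section log_density.
Context {R : realType} {N L : nat}.
Let V := ('cV[R]_N * 'cV[R]_L)%type.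
Variables s m a : R.
Hypotheses (s0 : 0 < s) (m0 : 0 < m) (a0 : 0 < a).
Implicit Types c z : V.

(* The logarithm of the density of (n, x), up to a constant, for
   m = lambda / nu and a = (nu + 1) / 2. *)
Definition logdens z : R :=
  - (dotv z.1 z.1 / (2 * s)) - a * \sum_i ln (1 + m * z.2 i ord0 ^+ 2).

Definition score c z : R :=
  - (dotv c.1 z.1 / s) -
  2 * a * m * \sum_i c.2 i ord0 * student_score m (z.2 i ord0).

(** Minus the second derivative of [logdens] along [c] and [c']; it depends on [z] only through the
    bounded [student_curv]. *)
Definition info c c' z : R :=
  dotv c.1 c'.1 / s +
  2 * a * m * \sum_i c.2 i ord0 * (c'.2 i ord0 * student_curv m (z.2 i ord0)).

Definition logdens_slope c : R := dotv c.1 c.1 / (2 * s) +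
  a * \sum_i `|c.2 i ord0| * (2 * (m + 1) + m * `|c.2 i ord0|).

(** A single majorant serves as Lipschitz constant of [logdens] along [c] for steps of size at most
    1 and as bound on the score. It sees [z] only through the Gaussian quantity [dotv c.1 z.1], so
    it has exponential moments even though [x] is heavy-tailed. *)
Definition growth c z : R := `|dotv c.1 z.1| / s + logdens_slope c.

Lemma logdens_line c z (h : R) :
  logdens (z + h *: c) = - ((dotv z.1 z.1 + 2 * h * dotv c.1 z.1 +
    h ^+ 2 * dotv c.1 c.1) / (2 * s)) -
  a * \sum_i ln (1 + m * (z.2 i ord0 + h * c.2 i ord0) ^+ 2).
Proof.
rewrite /logdens /= dotv_line; congr (_ - _ * _).
by apply: eq_bigr => i _; rewrite !mxE.
Qed.

Lemma score_line c c' z (h : R) :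
  score c (z + h *: c') = - ((dotv c.1 z.1 + h * dotv c.1 c'.1) / s) -
  2 * a * m * \sum_i c.2 i ord0 *
    student_score m (z.2 i ord0 + h * c'.2 i ord0).
Proof.
rewrite /score /= dotvDr dotvZr; congr (_ - _ * _).
by apply: eq_bigr => i _; rewrite !mxE.
Qed.

Lemma is_derive_logdens c z :
  is_derive (0 : R) 1 (fun h : R => logdens (z + h *: c)) (score c z).
Proof.
have -> : (fun h : R => logdens (z + h *: c)) =
  cst (- (2 * s)^-1) * (fun h : R => dotv z.1 z.1 + h * (2 * dotv c.1 z.1) +
    h ^+ 2 * dotv c.1 c.1) +
  cst (- a) * \sum_i (fun h : R => ln (1 + m * (z.2 i ord0 + h * c.2 i ord0) ^+ 2)).
  apply/funext => h; rewrite logdens_line fct_sumE.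
  rewrite -[RHS]/(- (2 * s)^-1 * (dotv z.1 z.1 + h * (2 * dotv c.1 z.1) +
    h ^+ 2 * dotv c.1 c.1) +
    - a * \sum_i ln (1 + m * (z.2 i ord0 + h * c.2 i ord0) ^+ 2)).
  by ring.
have dS := is_derive_sum (fun i => is_derive_student_ln (z.2 i ord0) (c.2 i ord0) m0).
apply: (is_derive_eq (is_deriveD
  (is_deriveM (is_derive_cst _ _ _) (is_derive_quadratic _ _ _))
  (is_deriveM (is_derive_cst _ _ _) dS))).
rewrite /GRing.scale/= /cst/= /score.
under eq_bigr do rewrite -(mulrA (2 * m)).
by rewrite -mulr_sumr; field; rewrite gt_eqF.
Qed.

Lemma is_derive_score c c' z :
  is_derive (0 : R) 1 (fun h : R => score c (z + h *: c')) (- info c c' z).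
Proof.
have -> : (fun h : R => score c (z + h *: c')) =
  cst (- s^-1) * (fun h : R => dotv c.1 z.1 + h * dotv c.1 c'.1) +
  cst (- (2 * a * m)) * \sum_i (cst (c.2 i ord0) *
    (fun h : R => student_score m (z.2 i ord0 + h * c'.2 i ord0))).
  apply/funext => h; rewrite score_line fct_sumE.
  rewrite -[RHS]/(- s^-1 * (dotv c.1 z.1 + h * dotv c.1 c'.1) +
    - (2 * a * m) * \sum_i c.2 i ord0 *
      student_score m (z.2 i ord0 + h * c'.2 i ord0)).
  by ring.
have dS := is_derive_sum (fun i => is_deriveM
  (is_derive_cst (c.2 i ord0) (0 : R) (1 : R))
  (is_derive_student_score (z.2 i ord0) (c'.2 i ord0) m0)).
apply: (is_derive_eq (is_deriveD
  (is_deriveM (is_derive_cst _ _ _) (is_derive_affine _ _))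
  (is_deriveM (is_derive_cst _ _ _) dS))).
rewrite /GRing.scale/= /cst/= /info.
under eq_bigr do rewrite mulr0 addr0.
by rewrite !mulr0 !addr0; ring.
Qed.

Lemma logdens_slope_ge0 c : 0 <= logdens_slope c.
Proof.
apply: addr_ge0; first by rewrite divr_ge0 ?dotv_ge0// mulr_ge0// ltW.
apply: mulr_ge0; first exact: ltW.
apply: sumr_ge0 => i _; apply: mulr_ge0 => //.
by apply: addr_ge0; rewrite mulr_ge0// ?addr_ge0// ltW.
Qed.

Lemma growth_ge0 c z : 0 <= growth c z.
Proof.
by rewrite addr_ge0 ?logdens_slope_ge0// divr_ge0// ltW.
Qed.

(** The bounds for the Gaussian and the Student parts both contain terms in [h^2]; the condition
    [|h| <= 1] turns them into multiples of [|h|]. *)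
Lemma logdens_lipschitz c z (h : R) : `|h| <= 1 ->
  `|logdens (z + h *: c) - logdens z| <= `|h| * growth c z.
Proof.
move=> h1; rewrite logdens_line /logdens.
set q := dotv c.1 c.1; set d := dotv c.1 z.1.
have q0 : 0 <= q by exact: dotv_ge0.
set S1 := \sum_i _; set S2 := \sum_i _.
have -> : - ((dotv z.1 z.1 + 2 * h * d + h ^+ 2 * q) / (2 * s)) - a * S1 -
  (- (dotv z.1 z.1 / (2 * s)) - a * S2) =
  - (h * (d / s)) - h * (h * (q / (2 * s))) - a * (S1 - S2).
  by field; rewrite gt_eqF.
rewrite (le_trans (ler_normB _ _))// /growth /logdens_slope addrA [leRHS]mulrDr lerD//.
  rewrite (le_trans (ler_normB _ _))// normrN [leRHS]mulrDr lerD//.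
    by rewrite normrM ler_wpM2l// normrM normfV (gtr0_norm s0).
  rewrite normrM ler_wpM2l// normrM (@ger0_norm _ (q / _)); last first.
    by rewrite divr_ge0// mulr_ge0// ltW.
  by rewrite -[leRHS]mul1r ler_wpM2r// divr_ge0// mulr_ge0// ltW.
rewrite normrM (gtr0_norm a0) mulrCA ler_wpM2l ?(ltW a0)//.
rewrite /S1 /S2 -sumrB (le_trans (ler_norm_sum _ _ _))// mulr_sumr.
apply: ler_sum => i _; rewrite (le_trans (ln_student_diff _ _ m0))//.
rewrite addrC addKr normrM -mulrA ler_wpM2l// ler_wpM2l// lerD2l.
by rewrite ler_wpM2l ?(ltW m0)// -[leRHS]mul1r ler_wpM2r.
Qed.

(** For the Student part, [2 m (1 + m^-1) = 2 (m + 1)] is the first summand of the factor in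
    [logdens_slope]. *)
Lemma score_growth c z : `|score c z| <= growth c z.
Proof.
rewrite (le_trans (ler_normB _ _))// normrN lerD//.
  by rewrite normrM normfV (gtr0_norm s0).
rewrite -[leLHS]add0r lerD//; first by rewrite divr_ge0 ?dotv_ge0// mulr_ge0// ltW.
rewrite normrM ger0_norm; last by rewrite !mulr_ge0// ltW.
rewrite [2 * a]mulrC -!mulrA ler_wpM2l ?(ltW a0)// mulrA.
rewrite (le_trans (ler_wpM2l _ (ler_norm_sum _ _ _)))//; first by rewrite mulr_ge0// ltW.
rewrite mulr_sumr; apply: ler_sum => i _.
rewrite normrM mulrCA ler_wpM2l//.
rewrite (@le_trans _ _ (2 * (m + 1)))//; last by rewrite lerDl mulr_ge0// ltW.
have -> : 2 * (m + 1) = 2 * m * (1 + m^-1) by field; rewrite gt_eqF.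
rewrite ler_wpM2l//; first by rewrite mulr_ge0// ltW.
exact: student_score_bound.
Qed.

(** The constant is that of [info_bound], because the Stein identity takes one [B] for both the
    increments and the derivative of the test function. *)
Lemma score_lipschitz c c' z (h : R) :
  `|score c (z + h *: c') - score c z| <= `|h| *
  (`|dotv c.1 c'.1| / s + 2 * a * m * \sum_i `|c.2 i ord0| * `|c'.2 i ord0|).
Proof.
rewrite score_line /score; set S1 := \sum_i _; set S2 := \sum_i _.
have -> : - ((dotv c.1 z.1 + h * dotv c.1 c'.1) / s) - 2 * a * m * S1 -
  (- (dotv c.1 z.1 / s) - 2 * a * m * S2) =
  - (h * (dotv c.1 c'.1 / s)) - 2 * a * m * (S1 - S2).
  by field; rewrite gt_eqF.
rewrite (le_trans (ler_normB _ _))// [leRHS]mulrDr lerD//.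
  by rewrite normrN !normrM normfV (gtr0_norm s0).
have am0 : 0 <= 2 * a * m by rewrite !mulr_ge0// ltW.
rewrite normrM (ger0_norm am0) mulrCA ler_wpM2l//.
rewrite /S1 /S2 -sumrB (le_trans (ler_norm_sum _ _ _))// mulr_sumr.
apply: ler_sum => i _; rewrite -mulrBr normrM mulrCA ler_wpM2l//.
by rewrite (le_trans (student_score_lipschitz _ _ m0))// addrC addKr normrM.
Qed.

Lemma info_bound c c' z :
  `|info c c' z| <=
  `|dotv c.1 c'.1| / s + 2 * a * m * \sum_i `|c.2 i ord0| * `|c'.2 i ord0|.
Proof.
rewrite (le_trans (ler_normD _ _))// lerD//.
  by rewrite !normrM normfV (gtr0_norm s0).
have am0 : 0 <= 2 * a * m by rewrite !mulr_ge0// ltW.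
rewrite normrM (ger0_norm am0) ler_wpM2l//.
rewrite (le_trans (ler_norm_sum _ _ _))//; apply: ler_sum => i _.
rewrite !normrM mulrA -[leRHS]mulr1 ler_wpM2l ?mulr_ge0//.
exact: student_curv_bound.
Qed.

Let measurable_coord i : measurable_fun setT (fun z : V => z.2 i ord0).
Proof. exact: (measurableT_comp (measurable_entry i ord0) measurable_snd). Qed.

Let measurable_den i :
  measurable_fun setT (fun z : V => 1 + m * z.2 i ord0 ^+ 2).
Proof.
apply: measurable_funD => //; apply: measurable_funM => //.
by apply: measurable_funX; exact: measurable_coord.
Qed.

Lemma measurable_logdens : measurable_fun setT logdens.
Proof.
apply: measurable_funB.
  apply: measurable_funN; apply: measurable_funM => //.
  by apply: measurable_sum => i; apply: measurable_funM => //;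
    exact: (measurableT_comp (measurable_entry i ord0) measurable_fst).
apply: measurable_funM => //; apply: measurable_sum => i.
by apply: measurableT_comp => //; exact: measurable_den.
Qed.

Lemma measurable_score c : measurable_fun setT (score c).
Proof.
apply: measurable_funB.
  apply: measurable_funN; apply: measurable_funM => //.
  exact: (measurableT_comp (measurable_dotv c.1) measurable_fst).
apply: measurable_funM => //; apply: measurable_sum => i.
apply: measurable_funM => //.
exact: (measurableT_comp (measurable_student_score m0) (measurable_coord i)).
Qed.

Lemma measurable_info c c' : measurable_fun setT (info c c').
Proof.
apply: measurable_funD => //; apply: measurable_funM => //.
apply: measurable_sum => i; do 2 apply: measurable_funM => //.
exact: (measurableT_comp (measurable_student_curv m0) (measurable_coord i)).
Qed.

Lemma measurable_growth c : measurable_fun setT (growth c).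
Proof.
apply: measurable_funD => //; apply: measurable_funM => //.
apply: measurableT_comp => //.
exact: (measurableT_comp (measurable_dotv c.1) measurable_fst).
Qed.

End log_density.

(** * Integrability of real-valued functions *)

Section real_integrable.
Context {d} {T : measurableType d} {R : realType}.
Variable mu : {measure set T -> \bar R}.
Implicit Types f g : T -> R.

Lemma integrable_EFinD f g :
  mu.-integrable setT (EFin \o f) -> mu.-integrable setT (EFin \o g) ->
  mu.-integrable setT (EFin \o (fun x => f x + g x)).
Proof. by move=> fi gi; exact: (integrableD measurableT fi gi). Qed.

Lemma integrable_EFinB f g :
  mu.-integrable setT (EFin \o f) -> mu.-integrable setT (EFin \o g) ->
  mu.-integrable setT (EFin \o (fun x => f x - g x)).
Proof. by move=> fi gi; exact: (integrableB measurableT fi gi). Qed.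

Lemma integrable_EFinZ k f :
  mu.-integrable setT (EFin \o f) ->
  mu.-integrable setT (EFin \o (fun x => k * f x)).
Proof. by move=> fi; exact: (integrableZl measurableT k fi). Qed.

Lemma le_integrable_EFin f g : measurable_fun setT f ->
  (forall x, `|f x| <= g x) -> mu.-integrable setT (EFin \o g) ->
  mu.-integrable setT (EFin \o f).
Proof.
move=> mf fg; apply: le_integrable => //; first exact/measurable_EFinP.
by move=> x _; rewrite /= lee_fin (le_trans (fg x))// ler_norm.
Qed.

End real_integrable.

(** * Shifts under the expectation, and exponential moments *)

Section expectation_shift.
Context {d} {Omega : measurableType d} {R : realType}.
Variable P : probability Omega R.
Context {N L : nat}.
Let V := ('cV[R]_N * 'cV[R]_L)%type.
Variables s m a : R.
Hypotheses (s0 : 0 < s) (m0 : 0 < m) (a0 : 0 < a).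
Variables (Z : {mfun Omega >-> V}) (C : R).
Hypothesis C0 : 0 <= C.
Hypothesis lawZ : forall A, measurable A -> P (Z @^-1` A) =
  (\int[lebesgue_vec R N \x lebesgue_vec R L]_(z in A)
     (C * expR (logdens s m a z))%:E)%E.

Local Notation ell := (logdens s m a).

Let measurable_comp_Z (F : V -> R) :
  measurable_fun setT F -> measurable_fun setT (fun w => F (Z w)).
Proof. by move=> mF; exact: (measurableT_comp mF). Qed.

Let measurable_ratio c :
  measurable_fun setT (fun z : V => expR (ell (z + c) - ell z)).
Proof.
apply: measurableT_comp => //; apply: measurable_funB.
  by apply: (measurableT_comp _ (measurable_shift_pair c)); exact: measurable_logdens.
exact: measurable_logdens.
Qed.

(** Both sides become Lebesgue integrals against [C * expR (ell z)]. Translating the left one by [c]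
    gives the right one, since the exponential ratio times [expR (ell z)] is
    [expR (ell (z + c))]. *)
Lemma ge0_expectation_shift (F : V -> R) c :
  measurable_fun setT F -> (forall z, 0 <= F z) ->
  (\int[P]_w (F (Z w))%:E =
   \int[P]_w (F (Z w + c)%R * expR (ell (Z w + c) - ell (Z w)))%:E)%E.
Proof.
move=> mF F0.
have mell : measurable_fun setT (fun z : V => C * expR (ell z)).
  apply: measurable_funM => //; apply: measurableT_comp => //.
  exact: measurable_logdens.
have ell0 (z : V) : 0 <= C * expR (ell z) by rewrite mulr_ge0 ?expR_ge0.
have dens (G : V -> R) : measurable_fun setT G -> (forall z, 0 <= G z) ->
  (\int[P]_w (G (Z w))%:E = \int[lebesgue_vec R N \x lebesgue_vec R L]_z
     (G z * (C * expR (ell z)))%:E)%E.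
  move=> mG G0.
  transitivity (\int[distribution P Z]_z (G z)%:E)%E.
    by rewrite ge0_integral_distribution//; exact/measurable_EFinP.
  rewrite (@ge0_integral_density _ _ _ (lebesgue_vec R N \x lebesgue_vec R L)%E _
    (fun z => C * expR (ell z)))//.
  exact/measurable_EFinP.
have mFc : measurable_fun setT (fun z : V => F (z + c)).
  exact: (measurableT_comp mF (measurable_shift_pair c)).
rewrite dens// (dens (fun z : V => F (z + c)%R * expR (ell (z + c) - ell z))).
- rewrite -(@ge0_integral_shift_pair _ _ _ c); last 2 first.
  + exact/measurable_EFinP/measurable_funM.
  + by move=> z; rewrite lee_fin mulr_ge0.
  apply: eq_integral => z _; congr EFin.
  by rewrite expRD expRN; field; rewrite gt_eqF ?expR_gt0.
- exact: measurable_funM.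
- by move=> z; rewrite mulr_ge0 ?expR_ge0.
Qed.

(** The exponential ratio is nonnegative, so it commutes with positive and negative parts. *)
Lemma expectation_shift (F : V -> R) c : measurable_fun setT F ->
  (\int[P]_w (F (Z w))%:E =
   \int[P]_w (F (Z w + c)%R * expR (ell (Z w + c) - ell (Z w)))%:E)%E.
Proof.
move=> mF; rewrite integralE [RHS]integralE.
rewrite !funerpos !funerneg /=; congr (_ - _)%E.
  rewrite (ge0_expectation_shift (F := F^\+) c)//; last exact: measurable_funrpos.
  by apply: eq_integral => w _; rewrite /funrpos maxr_pMl ?expR_ge0// mul0r.
rewrite (ge0_expectation_shift (F := F^\-) c)//; last exact: measurable_funrneg.
by apply: eq_integral => w _; rewrite /funrneg -mulNr maxr_pMl ?expR_ge0// mul0r.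
Qed.

(* The shift of n by - s v multiplies the density by a constant times
   exp(v . n), and F = 1 makes that expectation finite. *)
Lemma integrable_expR_dotv (v : 'cV[R]_N) :
  P.-integrable setT (EFin \o (fun w => expR (dotv v (Z w).1))).
Proof.
have mexp (u : 'cV[R]_N) :
    measurable_fun setT (fun w => expR (dotv u (Z w).1)).
  apply: measurableT_comp => //.
  apply: (measurable_comp_Z (F := fun z => dotv u z.1)).
  exact: (measurableT_comp (measurable_dotv u) measurable_fst).
apply/integrableP; split; first exact/measurable_EFinP.
under eq_integral do rewrite /= ger0_norm ?expR_ge0//.
pose c : V := (- s *: v, 0).
pose k := expR (- (dotv c.1 c.1 / (2 * s))).
have k0 : 0 < k by exact: expR_gt0.
have shiftE w : expR (ell (Z w + c) - ell (Z w)) = k * expR (dotv v (Z w).1).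
  rewrite -[Z w + c]/(Z w + c) -[c in Z w + c]scale1r logdens_line /logdens.
  rewrite /k -expRD; congr expR.
  have -> : \sum_i ln (1 + m * ((Z w).2 i ord0 + 1 * c.2 i ord0) ^+ 2) =
      \sum_i ln (1 + m * (Z w).2 i ord0 ^+ 2).
    by apply: eq_bigr => i _; rewrite mxE mulr0 addr0.
  have -> : dotv c.1 (Z w).1 = - s * dotv v (Z w).1.
    by rewrite dotvC dotvZr dotvC.
  by field; rewrite gt_eqF.
have E1 : (1 = k%:E * \int[P]_w (expR (dotv v (Z w).1))%:E)%E.
  rewrite -ge0_integralZl//; last 2 first.
  - exact/measurable_EFinP.
  - by rewrite lee_fin ltW.
  transitivity (\int[P]_w (cst 1 (Z w) : R)%:E)%E.
    rewrite -[RHS]/(\int[P]_(w in setT) cst 1%E w)%E.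
    by rewrite integral_cst// mul1e; exact/esym/probability_setT.
  rewrite (ge0_expectation_shift c)//.
  by apply: eq_integral => w _; rewrite mul1r shiftE EFinM.
rewrite ltey; apply/eqP => Eoo; move: E1.
by rewrite Eoo gt0_muley// lte_fin.
Qed.

(** The inequality [exp |t| <= exp t + exp (- t)] reduces this to the moments of [exp (v . n)] for
    [v = (k / s) c.1] and its opposite; the slope only contributes a constant factor. *)
Lemma integrable_expR_growth k c : 0 <= k ->
  P.-integrable setT (EFin \o (fun w => expR (k * growth s m a c (Z w)))).
Proof.
move=> k0.
pose v := (k / s) *: c.1.
pose K := expR (k * logdens_slope s m a c).
have iK : P.-integrable setT (EFin \o (fun w => K *
    (expR (dotv v (Z w).1) + expR (dotv (- v) (Z w).1)))).
  by apply: integrable_EFinZ; apply: integrable_EFinD; exact: integrable_expR_dotv.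
apply: le_integrable_EFin iK => //.
  apply: measurableT_comp => //; apply: measurable_funM => //.
  by apply: measurable_comp_Z; exact: measurable_growth.
move=> w; rewrite ger0_norm ?expR_ge0//.
rewrite /growth mulrDr expRD mulrC ler_wpM2l ?expR_ge0//.
rewrite dotvNl; have -> : dotv v (Z w).1 = k / s * dotv c.1 (Z w).1.
  by rewrite dotvC dotvZr dotvC.
set t := dotv _ _.
have -> : k * (`|t| / s) = `|k / s * t|.
  by rewrite !normrM normfV (gtr0_norm s0) (ger0_norm k0); ring.
have [t0|t0] := ger0P (k / s * t); first by rewrite lerDl expR_ge0.
by rewrite lerDr expR_ge0.
Qed.

End expectation_shift.

(** * The Stein identity along a direction *)

Section stein.
Context {d} {Omega : measurableType d} {R : realType}.
Variable P : probability Omega R.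
Context {N L : nat}.
Let V := ('cV[R]_N * 'cV[R]_L)%type.
Variables s m a : R.
Hypotheses (s0 : 0 < s) (m0 : 0 < m) (a0 : 0 < a).
Variables (Z : {mfun Omega >-> V}) (C : R).
Hypothesis C0 : 0 <= C.
Hypothesis lawZ : forall A, measurable A -> P (Z @^-1` A) =
  (\int[lebesgue_vec R N \x lebesgue_vec R L]_(z in A)
     (C * expR (logdens s m a z))%:E)%E.

Local Notation ell := (logdens s m a).

(** Follows from [1 + u <= exp u], taken at [- u] when [u >= 0] and at [u] otherwise. *)
Lemma normr_expRB1 (u : R) : `|expR u - 1| <= `|u| * expR `|u|.
Proof.
have [u0|u0] := ger0P u.
  rewrite ger0_norm ?subr_ge0 -?[1]expR0 ?ler_expR//.
  have := expR_ge1Dx (- u); rewrite expR0 expRN => h.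
  have e0 := expR_gt0 u.
  have : (1 - u) * expR u <= 1.
    by rewrite -[leRHS](mulVf (lt0r_neq0 e0)) ler_wpM2r// ltW.
  by nra.
rewrite ler0_norm; last by rewrite subr_le0 -[leRHS]expR0 ler_expR ltW.
have := expR_ge1Dx u.
have : 1 <= expR (- u) by rewrite -[leLHS]expR0 ler_expR oppr_ge0 ltW.
by nra.
Qed.

(** The steps [1 / (k + 1)] make the derivative a limit of a sequence, the form in which dominated
    convergence applies. *)
Lemma is_derive_seq (f : R -> R) (df : R) : is_derive (0 : R) 1 f df ->
  (fun k : nat => k.+1%:R * (f k.+1%:R^-1 - f 0)) @ \oo --> df.
Proof.
move=> [fd fdf].
have h0 : harmonic @ \oo --> ((0 : R)^').
  move=> A /(@cvg_harmonic R) [n _ nA]; exists n => // k nk.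
  by apply: nA => //=; rewrite gt_eqF.
have fc : (fun h : R => h^-1 *: ((f \o shift 0) (h *: 1) - f 0)) @ 0^' --> df.
  by rewrite -fdf; exact: fd.
have -> : (fun k : nat => k.+1%:R * (f k.+1%:R^-1 - f 0)) =
    (fun h : R => h^-1 *: ((f \o shift 0) (h *: 1) - f 0)) \o harmonic.
  by apply/funext => k /=; rewrite invrK /shift /= addr0 /GRing.scale /= mulr1.
exact: cvg_comp h0 fc.
Qed.

Variables (c : V) (F dF : V -> R) (B : R).
Hypotheses (mF : measurable_fun setT F) (mdF : measurable_fun setT dF).
Hypothesis F2 : P.-integrable setT (EFin \o (fun w => F (Z w) ^+ 2)).
Hypothesis F_dF : forall z, is_derive (0 : R) 1 (fun h : R => F (z + h *: c)) (dF z).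
Hypothesis F_lip : forall z (h : R), `|F (z + h *: c) - F z| <= `|h| * B.
Hypothesis dF_le : forall z, `|dF z| <= B.

Let sc := score s m a c.
Let K z := growth s m a c z.
Let h_ (k : nat) : R := k.+1%:R^-1.
(** At [Z] this has the same expectation as [F], by [expectation_shift]; hence [quot] has mean
    zero. *)
Let weighted k (z : V) : R :=
  F (z + h_ k *: c) * expR (ell (z + h_ k *: c) - ell z).
Let quot k z := k.+1%:R * (weighted k z - F z).
Let bound z := B * expR (K z) + (F z ^+ 2 + expR (4 * K z)).

Let h_itv k : `|h_ k| <= 1.
Proof. by rewrite /h_ normfV ger0_norm// invf_le1// ler1n. Qed.

(** The increment of the product splits into an increment of [F], contributing at most [B exp K],
    and one of the exponential. The latter is at most [|F| K exp K <= |F| exp (2 K) <= F^2 + exp (4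
    K)], which separates the merely square integrable [F] from an exponential moment. *)
Let quot_bound k z : `|quot k z| <= bound z.
Proof.
have K0 : 0 <= K z by apply: growth_ge0.
set u := ell (z + h_ k *: c) - ell z.
have uK : `|u| <= h_ k * K z.
  by rewrite -[h_ k]ger0_norm ?invr_ge0//; apply: logdens_lipschitz.
have h1 : h_ k <= 1 by rewrite -(@ger0_norm _ (h_ k)) ?invr_ge0.
have uK1 : `|u| <= K z by rewrite (le_trans uK)// -[leRHS]mul1r ler_wpM2r.
have hk : k.+1%:R * h_ k = 1 by rewrite /h_ mulfV.
have -> : quot k z = k.+1%:R * (F (z + h_ k *: c) - F z) * expR u +
    F z * (k.+1%:R * (expR u - 1)) by rewrite /quot /weighted -/u; ring.
rewrite (le_trans (ler_normD _ _))// lerD//.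
  rewrite normrM [`|expR u|]ger0_norm ?expR_ge0// ler_pM//.
    rewrite normrM ger0_norm// (le_trans (ler_wpM2l _ (F_lip _ _)))//.
    by rewrite (@ger0_norm _ (h_ k)) ?invr_ge0// mulrA hk mul1r.
  by rewrite ler_expR (le_trans (ler_norm _)).
have KeK : `|k.+1%:R * (expR u - 1)| <= expR (2 * K z).
  rewrite normrM ger0_norm//.
  rewrite (le_trans (ler_wpM2l _ (normr_expRB1 u)))//.
  have -> : 2 * K z = K z + K z by ring.
  rewrite expRD mulrA ler_pM ?mulr_ge0 ?expR_ge0 ?ler_expR//.
  rewrite (le_trans (ler_wpM2l _ uK))// mulrA hk mul1r.
  by rewrite (le_trans _ (expR_ge1Dx _))// lerDr.
rewrite normrM (le_trans (ler_wpM2l _ KeK))//.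
have -> : 4 * K z = 2 * K z + 2 * K z by ring.
rewrite expRD -(real_normK (num_real (F z))).
by have := sqr_ge0 (`|F z| - expR (2 * K z));
  have := normr_ge0 (F z); have := expR_ge0 (2 * K z); nra.
Qed.

(** This is the product rule at [h = 0], where the exponential ratio has value 1 and derivative
    [sc z]. *)
Let quot_cvg z : (fun k => quot k z) @ \oo --> dF z + F z * sc z.
Proof.
have dell : is_derive (0 : R) 1 (fun h : R => ell (z + h *: c) - ell z) (sc z).
  apply: (is_derive_eq (is_deriveB (is_derive_logdens a s0 m0 c z)
    (is_derive_cst (ell z) _ _))).
  by rewrite subr0.
have de : is_derive (0 : R) 1 (fun h : R => expR (ell (z + h *: c) - ell z))
    (expR (ell (z + (0 : R) *: c) - ell z) * sc z).
  exact: (@is_derive1_comp R (@expR R) (fun h => ell (z + h *: c) - ell z)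
    0 _ _ (is_derive_expR _) dell).
have dq : is_derive (0 : R) 1
    (fun h : R => F (z + h *: c) * expR (ell (z + h *: c) - ell z))
    (dF z + F z * sc z).
  apply: (is_derive_eq (is_deriveM (F_dF z) de)).
  by rewrite scale0r addr0 subrr expR0 /GRing.scale /= !mul1r addrC.
by have := is_derive_seq dq; rewrite scale0r addr0 subrr expR0 mulr1.
Qed.

Let integrable_growth k : 0 <= k ->
  P.-integrable setT (EFin \o (fun w => expR (k * K (Z w)))).
Proof. by move=> k0; exact: (integrable_expR_growth s0 C0 lawZ). Qed.

Let measurable_comp (G : V -> R) :
  measurable_fun setT G -> measurable_fun setT (fun w => G (Z w)).
Proof. by move=> mG; exact: (measurableT_comp mG). Qed.

Let measurable_weighted k : measurable_fun setT (weighted k).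
Proof.
have mell := @measurable_logdens R N L s m a.
apply: measurable_funM.
  exact: (measurableT_comp mF (measurable_shift_pair (h_ k *: c))).
apply: measurableT_comp => //; apply: measurable_funB => //.
exact: (measurableT_comp mell (measurable_shift_pair (h_ k *: c))).
Qed.

Let integrable_bound : P.-integrable setT (EFin \o (fun w => bound (Z w))).
Proof.
apply: integrable_EFinD; last by apply: integrable_EFinD => //; exact: integrable_growth.
apply: integrable_EFinZ; have := integrable_growth (ler01).
by under eq_fun do rewrite mul1r.
Qed.

Let integrable_F : P.-integrable setT (EFin \o (fun w => F (Z w))).
Proof.
apply: (@le_integrable_EFin _ _ _ _ _ (fun w => 1 + F (Z w) ^+ 2)).
- exact: measurable_comp.
- move=> w; rewrite -(real_normK (num_real (F (Z w)))).
  by have := sqr_ge0 (`|F (Z w)| - 1); have := normr_ge0 (F (Z w)); nra.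
- apply: integrable_EFinD => //; exact: finite_measure_integrable_cst.
Qed.

Let integrable_dF : P.-integrable setT (EFin \o (fun w => dF (Z w))).
Proof.
apply: (@le_integrable_EFin _ _ _ _ _ (fun=> B)) => //.
- exact: measurable_comp.
- exact: finite_measure_integrable_cst.
Qed.

Let measurable_quot k : measurable_fun setT (fun w => quot k (Z w)).
Proof.
apply: measurable_comp; apply: measurable_funM => //.
by apply: measurable_funB.
Qed.

Let integrable_quot k : P.-integrable setT (EFin \o (fun w => quot k (Z w))).
Proof. by apply: le_integrable_EFin integrable_bound. Qed.

Let integral_quot k : (\int[P]_w (quot k (Z w))%:E = 0)%E.
Proof.
(* Since [weighted k = F + quot k / (k + 1)], its integrability comes from the majorant of [quot],
   and the integral of the difference may be split. *)
have iW : P.-integrable setT (EFin \o (fun w => weighted k (Z w))).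
  have := integrable_EFinD (integrable_EFinZ k.+1%:R^-1 (integrable_quot k)) integrable_F.
  by under eq_fun do rewrite /quot mulKf// subrK.
have E : \int[P]_w (quot k (Z w)) = 0.
  rewrite RintegralZl//; last exact: integrable_EFinB.
  rewrite RintegralB// /Rintegral.
  rewrite (expectation_shift C0 lawZ (h_ k *: c) mF).
  by rewrite subrr mulr0.
rewrite -[LHS](fineK (integrable_fin_num measurableT (integrable_quot k))).
by congr EFin; exact: E.
Qed.

(** Dominated convergence along [quot], all of whose integrals vanish. *)
Let integrable_stein_sum_and_null :
  P.-integrable setT (EFin \o (fun w => dF (Z w) + F (Z w) * sc (Z w))) /\
  (\int[P]_w (dF (Z w) + F (Z w) * sc (Z w))%:E = 0)%E.
Proof.
have msc : measurable_fun setT (fun w => sc (Z w)).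
  by apply: measurable_comp; exact: measurable_score.
have [||||| ifl _ cfl] := @dominated_convergence _ _ _ P setT measurableT
  (fun k => EFin \o (fun w => quot k (Z w)))
  (EFin \o (fun w => dF (Z w) + F (Z w) * sc (Z w)))
  (EFin \o (fun w => bound (Z w))).
- by move=> k; exact/measurable_EFinP.
- apply/measurable_EFinP; apply: measurable_funD; first exact: measurable_comp.
  by apply: measurable_funM => //; exact: measurable_comp.
- by apply: aeW => w _; apply: cvg_EFin; [exact: nearW|exact: quot_cvg].
- exact: integrable_bound.
- by apply: aeW => w k _; rewrite /= lee_fin.
split=> //; apply/esym; apply: cvg_unique cfl => //.
rewrite (_ : [sequence _]_n = cst 0%E); first exact: cvg_cst.
by apply/funext => k; exact: integral_quot.
Qed.

(** The sum with [dF] is integrable, and [dF] is bounded. *)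
Lemma integrable_stein :
  P.-integrable setT (EFin \o (fun w => F (Z w) * sc (Z w))).
Proof.
have := integrable_EFinB integrable_stein_sum_and_null.1 integrable_dF.
by under eq_fun do rewrite addrC addKr.
Qed.

Lemma stein : \int[P]_w (F (Z w) * sc (Z w)) = - \int[P]_w dF (Z w).
Proof.
apply/eqP; rewrite -addr_eq0 addrC -RintegralD//; last exact: integrable_stein.
by rewrite /Rintegral integrable_stein_sum_and_null.2.
Qed.

End stein.

(** * The mean curvature of the Student kernel *)

Section expectation_curvature.
Context {d} {Omega : measurableType d} {R : realType}.
Variable P : probability Omega R.
Context {N L : nat}.
Let V := ('cV[R]_N * 'cV[R]_L)%type.
Variables s m a : R.
Hypotheses (s0 : 0 < s) (m0 : 0 < m) (a0 : 0 < a).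
Variables (Z : {mfun Omega >-> V}) (C : R).
Hypothesis C0 : 0 <= C.
Hypothesis lawZ : forall A, measurable A -> P (Z @^-1` A) =
  (\int[lebesgue_vec R N \x lebesgue_vec R L]_(z in A)
     (C * expR (logdens s m a z))%:E)%E.
Variable i : 'I_L.

Let X w : R := (Z w).2 i ord0.
Let q w : R := student_weight m (X w).

Let mX : measurable_fun setT X.
Proof.
apply: (measurableT_comp (f := fun z : V => z.2 i ord0)) => //.
exact: (measurableT_comp (measurable_entry i ord0) measurable_snd).
Qed.

Let integrable_bounded (f : Omega -> R) B : measurable_fun setT f ->
  (forall w, `|f w| <= B) -> P.-integrable setT (EFin \o f).
Proof.
move=> mf fB; apply: (@le_integrable_EFin _ _ _ _ _ (fun=> B)) => //.
exact: finite_measure_integrable_cst.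
Qed.

(** The Stein identity along the [i]-th axis of [x] for the test function [student_score e]. The
    score there is [- 2 a m student_score m], and [m t^2 / (1 + m t^2) = 1 - student_weight m t]
    leaves only weights. *)
Let stein_student e : 0 < e ->
  \int[P]_w (2 * a * ((1 - q w) * student_weight e (X w))
    - student_curv e (X w)) = 0.
Proof.
move=> e0.
pose c : V := (0, delta_mx i ord0).
have cE (z : V) (h : R) : (z + h *: c).2 i ord0 = z.2 i ord0 + h * 1.
  by rewrite !mxE !eqxx.
have mcoord : measurable_fun setT (fun z : V => z.2 i ord0).
  exact: (measurableT_comp (measurable_entry i ord0) measurable_snd).
have mF : measurable_fun setT (fun z : V => student_score e (z.2 i ord0)).
  exact: (measurableT_comp (measurable_student_score e0)).
have mdF : measurable_fun setT (fun z : V => student_curv e (z.2 i ord0)).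
  exact: (measurableT_comp (measurable_student_curv e0)).
have F2 : P.-integrable setT (EFin \o (fun w => student_score e (X w) ^+ 2)).
  apply: (@integrable_bounded _ ((1 + e^-1) ^+ 2)).
    by apply: measurable_funX; exact: (measurableT_comp mF).
  move=> w; rewrite normrX lerXn2r ?nnegrE//; last exact: student_score_bound.
  by rewrite addr_ge0// invr_ge0 ltW.
have dF z : is_derive (0 : R) 1
    (fun h : R => student_score e ((z + h *: c).2 i ord0))
    (student_curv e (z.2 i ord0)).
  under eq_fun do rewrite cE.
  by have := is_derive_student_score (z.2 i ord0) 1 e0; rewrite mul1r.
have Fl z (h : R) : `|student_score e ((z + h *: c).2 i ord0) -
    student_score e (z.2 i ord0)| <= `|h| * 1.
  rewrite cE (le_trans (student_score_lipschitz _ _ e0))//.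
  by rewrite addrC addKr !mulr1.
have Fb z : `|student_curv e ((z : V).2 i ord0)| <= 1 by exact: student_curv_bound.
have iF := integrable_stein s0 m0 a0 C0 lawZ mF mdF F2 dF Fl Fb.
have EF := stein s0 m0 a0 C0 lawZ mF mdF F2 dF Fl Fb.
have SE w : 2 * a * ((1 - q w) * student_weight e (X w)) =
    - (student_score e (X w) * score s m a c (Z w)).
  rewrite /score /c /= /dotv big1 ?mul0r ?oppr0 ?sub0r; last first.
    by move=> j _; rewrite mxE mul0r.
  rewrite (bigD1 i)//= mxE !eqxx mul1r big1 ?addr0; last first.
    by move=> j /negbTE ji; rewrite mxE ji mul0r.
  rewrite /q /student_weight /student_score -/(X w).
  have D1 := student_den_gt0 (X w) m0; have D2 := student_den_gt0 (X w) e0.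
  by field; rewrite !gt_eqF.
under eq_Rintegral do rewrite SE.
rewrite RintegralB//.
- have -> : \int[P]_w - (student_score e (X w) * score s m a c (Z w)) =
    - \int[P]_w (student_score e (X w) * score s m a c (Z w)).
    rewrite -mulN1r -RintegralZl//.
    by apply: eq_Rintegral => w _; rewrite mulN1r.
  by rewrite EF opprK subrr.
- have := integrable_EFinZ (-1) iF.
  by under eq_fun do rewrite mulN1r.
- apply: (@integrable_bounded _ 1); first exact: (measurableT_comp mdF).
  by move=> w; exact: student_curv_bound.
Qed.

(** Let [q1] and [q2] be the first two moments of [q]. Taking [e = m] gives
    [(2 a + 1) q1 = (2 a + 2) q2], and [e -> 0] gives [2 a (1 - q1) = 1]; these determine the mean
    curvature [2 q2 - q1]. *)
Lemma expectation_curv :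
  \int[P]_w student_curv m (X w) = (2 * a - 1) / (2 * a + 2).
Proof.
have mweight e : 0 < e -> measurable_fun setT (fun w => student_weight e (X w)).
  by move=> e0; exact: (measurableT_comp (measurable_student_weight e0)).
have q01 w : 0 < q w <= 1 by exact: student_weight_itv.
have iq : P.-integrable setT (EFin \o q).
  apply: (@integrable_bounded _ 1); first exact: mweight.
  by move=> w; have /andP[q0 q1] := q01 w; rewrite gtr0_norm.
have iq2 : P.-integrable setT (EFin \o (fun w => q w ^+ 2)).
  apply: (@integrable_bounded _ 1); first by apply: measurable_funX; exact: mweight.
  move=> w; have /andP[q0 q1] := q01 w.
  by rewrite ger0_norm ?exprn_ge0 ?exprn_ile1// ltW.
have i1 : P.-integrable setT (EFin \o (fun=> 1 : R)).
  exact: finite_measure_integrable_cst.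
have E1 : \int[P]_w (1 : R) = 1.
  by rewrite Rintegral_cst// mul1r; exact: (congr1 fine (probability_setT P)).
have eqA := stein_student m0.
(* The limit e -> 0 stands for the test function t, which is not itself
   admissible: x_i need not be square integrable. *)
have eqB : \int[P]_w (2 * a * (1 - q w) - 1) = 0.
  pose h_ (k : nat) : R := k.+1%:R^-1.
  have h0 k : 0 < h_ k by rewrite invr_gt0.
  pose f k w := 2 * a * ((1 - q w) * student_weight (h_ k) (X w))
    - student_curv (h_ k) (X w).
  (* The test functions are not bounded uniformly in [k], but this combination is: it involves only
     weights in (0, 1] and the curvature. *)
  have fb k w : `|f k w| <= 2 * a + 1.
    rewrite (le_trans (ler_normB _ _))// lerD ?student_curv_bound//.
    have /andP[q0 q1] := q01 w.
    have /andP[r0 r1] := student_weight_itv (X w) (h0 k).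
    have qr0 : 0 <= (1 - q w) * student_weight (h_ k) (X w).
      by rewrite mulr_ge0 ?subr_ge0 ?(ltW r0).
    have a2 : 0 <= 2 * a by rewrite mulr_ge0 ?(ltW a0).
    rewrite (ger0_norm (mulr_ge0 a2 qr0)) -[leRHS]mulr1 ler_wpM2l//.
    by rewrite mulr_ile1 ?subr_ge0 ?(ltW r0)// lerBlDr lerDl ltW.
  have mf k : measurable_fun setT (f k).
    apply: measurable_funB.
      apply: measurable_funM => //; apply: measurable_funM; last exact: mweight.
      by apply: measurable_funB => //; exact: mweight.
    exact: (measurableT_comp (measurable_student_curv (h0 k))).
  have r1 w : (fun k => student_weight (h_ k) (X w)) @ \oo --> (1 : R).
    rewrite -[X in _ --> X]invr1; apply: cvgV; first by rewrite oner_eq0.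
    rewrite -[X in _ --> X]addr0 -[X in _ + X](mul0r (X w ^+ 2)).
    apply: cvgD; first exact: cvg_cst.
    by apply: cvgMl; exact: cvg_harmonic.
  have r2 w : (fun k => student_weight (h_ k) (X w) ^+ 2) @ \oo --> (1 : R) ^+ 2.
    by under eq_fun do rewrite expr2; rewrite expr2; apply: cvgM; exact: r1.
  have fc w : (fun k => f k w) @ \oo --> 2 * a * (1 - q w) - 1.
    have -> : 2 * a * (1 - q w) - 1 = 2 * a * ((1 - q w) * 1) - (2 * 1 ^+ 2 - 1).
      by ring.
    apply: cvgB; first by apply: cvgMr; apply: cvgMr; exact: r1.
    apply: cvgB; last exact: r1.
    by apply: cvgMr; exact: r2.
  have [||||| _ _ cfl] := @dominated_convergence _ _ _ P setT measurableT
    (fun k => EFin \o f k) (EFin \o (fun w => 2 * a * (1 - q w) - 1))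
    (EFin \o (fun=> 2 * a + 1)).
  - by move=> k; exact/measurable_EFinP.
  - apply/measurable_EFinP; apply: measurable_funB => //.
    by apply: measurable_funM => //; apply: measurable_funB => //; exact: mweight.
  - by apply: aeW => w _; apply: cvg_EFin; [exact: nearW|exact: fc].
  - exact: finite_measure_integrable_cst.
  - by apply: aeW => w k _; rewrite /= lee_fin.
  suff : (\int[P]_w (EFin \o (fun w => 2 * a * (1 - q w) - 1)%R) w = 0)%E.
    by rewrite /Rintegral => ->.
  apply/esym; apply: cvg_unique cfl => //.
  rewrite (_ : [sequence _]_n = cst 0%E); first exact: cvg_cst.
  apply/funext => k /=.
  have ifk : P.-integrable setT (EFin \o f k).
    exact: (@integrable_bounded _ (2 * a + 1)).
  rewrite -[LHS](fineK (integrable_fin_num measurableT ifk)); congr EFin.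
  exact: (stein_student (h0 k)).
have EA : (2 * a + 1) * \int[P]_w q w = (2 * a + 2) * \int[P]_w (q w ^+ 2).
  apply/eqP; rewrite -subr_eq0 -!RintegralZl// -RintegralB//; last 2 first.
  - exact: integrable_EFinZ.
  - exact: integrable_EFinZ.
  apply/eqP; rewrite -[RHS]eqA; apply: eq_Rintegral => w _.
  by rewrite /student_curv -/(q w); ring.
have EB : 2 * a - 1 = 2 * a * \int[P]_w q w.
  have -> : 2 * a - 1 = (2 * a - 1) * \int[P]_w 1 by rewrite E1 mulr1.
  apply/eqP; rewrite -subr_eq0 -!RintegralZl// -RintegralB//; last 2 first.
  - exact: integrable_EFinZ.
  - exact: integrable_EFinZ.
  apply/eqP; rewrite -[RHS]eqB; apply: eq_Rintegral => w _; ring.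
have -> : \int[P]_w student_curv m (X w) =
    2 * \int[P]_w (q w ^+ 2) - \int[P]_w q w.
  by rewrite -RintegralZl// -RintegralB//; exact: integrable_EFinZ.
have a1 : 2 * a + 2 != 0 by rewrite gt_eqF// addr_gt0// mulr_gt0.
have -> : \int[P]_w (q w ^+ 2) = (2 * a + 1) * \int[P]_w q w / (2 * a + 2).
  by rewrite EA mulrAC mulfV// mul1r.
rewrite EB; field.
by rewrite a1.
Qed.

End expectation_curvature.

(** * The Hessian of the logarithm of the joint density *)

Lemma derive_line {R : realType} {n : nat} (f : 'cV[R]_n -> R) (x v : 'cV[R]_n)
    (df : R) :
  is_derive (0 : R) 1 (fun h : R => f (x + h *: v)) df -> 'D_v f x = df.
Proof.
move=> [_ <-]; rewrite /derive; congr (lim (_ @ 0^')).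
apply/funext => h /=; rewrite /shift /= addr0 scale0r addr0 [x + _]addrC.
by rewrite [h%:A]mulr1.
Qed.

Section joint_density.
Context {R : realType} {N L : nat}.
Variables s nu lambda : R.
Hypotheses (s0 : 0 < s) (nu0 : 0 < nu) (lambda0 : 0 < lambda).

Local Notation m := (lambda / nu).
Local Notation a := ((nu + 1) / 2).

(** The Gaussian and Student normalizing constants, with the Gamma values left unevaluated. Only the
    sign matters; strict positivity is later deduced from total mass 1. *)
Definition joint_const : R := (Num.sqrt ((2 * pi) ^+ N * \det (s%:M : 'M[R]_N)))^-1 *
  ((Gamma ((nu + 1) / 2) / Gamma (nu / 2)) ^+ L *
   (lambda / (pi * nu)) `^ (L%:R / 2)).

Lemma joint_const_ge0 : 0 <= joint_const.
Proof.
apply: mulr_ge0; first by rewrite invr_ge0 sqrtr_ge0.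
apply: mulr_ge0; last exact: powR_ge0.
by apply/exprn_ge0/divr_ge0; exact: Gamma_ge0.
Qed.

Lemma density_logdens (v : 'cV[R]_N) (x : 'cV[R]_L) :
  mvnormal_pdf 0 s%:M v * student_pdf nu lambda x =
  joint_const * expR (logdens s m a (v, x)).
Proof.
rewrite /mvnormal_pdf /student_pdf /joint_const subr0.
have -> : \prod_(i < L) (1 + lambda * x i ord0 ^+ 2 / nu) `^ (- ((nu + 1) / 2)) =
    expR (- a * \sum_i ln (1 + m * x i ord0 ^+ 2)).
  rewrite mulr_sumr expR_sum; apply: eq_bigr => i _.
  have -> : lambda * x i ord0 ^+ 2 / nu = m * x i ord0 ^+ 2 by ring.
  by rewrite /powR gt_eqF// student_den_gt0// divr_gt0.
have -> : (v^T *m invmx s%:M *m v) ord0 ord0 = dotv v v / s.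
  by rewrite invmx_scalar mul_mx_scalar -scalemxAl mxE -dotvE mulrC.
have -> : logdens s m a (v, x) = - (dotv v v / s) / 2 +
    - a * \sum_i ln (1 + m * x i ord0 ^+ 2).
  by rewrite /logdens /=; field; rewrite !gt_eqF.
rewrite expRD mulNr; ring.
Qed.

Variable Phi : 'M[R]_(N, L).

(* Moving x by b at fixed y = Phi x + n moves n by - Phi b. *)
Definition data_direction (b : 'cV[R]_L) : 'cV[R]_N * 'cV[R]_L :=
  (- (Phi *m b), b).

Lemma joint_pdf_logdens (y : 'cV[R]_N) (x : 'cV[R]_L) :
  joint_pdf Phi s nu lambda y x =
  joint_const * expR (logdens s m a (y - Phi *m x, x)).
Proof. by rewrite -density_logdens /joint_pdf /mvnormal_pdf subr0. Qed.

Lemma residual_line (y : 'cV[R]_N) (x b : 'cV[R]_L) (h : R) :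
  (y - Phi *m (x + h *: b), x + h *: b) =
  (y - Phi *m x, x) + h *: data_direction b.
Proof. by congr pair; rewrite mulmxDr -scalemxAr opprD addrA -scalerN. Qed.

(** When [x] moves along [b] at fixed [y], the pair (residual, [x]) moves along [data_direction b].
    Both partial derivatives are thus line derivatives, first of [logdens] and then of [score].
    Positivity of the constant lets the logarithm of the product split. *)
Lemma hessian_joint_pdf (y : 'cV[R]_N) (x : 'cV[R]_L) i j :
  0 < joint_const ->
  hessian (fun x => ln (joint_pdf Phi s nu lambda y x)) x i j =
  - info s m a (data_direction (delta_mx j ord0))
      (data_direction (delta_mx i ord0)) (y - Phi *m x, x).
Proof.
move=> K0; have m0 : 0 < m by rewrite divr_gt0.
rewrite mxE.
have -> : 'D_(delta_mx j ord0) (fun x => ln (joint_pdf Phi s nu lambda y x)) =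
    (fun x => score s m a (data_direction (delta_mx j ord0)) (y - Phi *m x, x)).
  apply/funext => x'; apply: derive_line.
  under eq_fun do rewrite joint_pdf_logdens residual_line lnM ?posrE ?expR_gt0// expRK.
  have dl := is_derive_logdens a s0 m0 (data_direction (delta_mx j ord0))
    (y - Phi *m x', x').
  have -> : (fun h : R => ln joint_const + logdens s m a
      ((y - Phi *m x', x') + h *: data_direction (delta_mx j ord0))) =
    cst (ln joint_const) + (fun h : R => logdens s m a
      ((y - Phi *m x', x') + h *: data_direction (delta_mx j ord0))) by [].
  apply: (is_derive_eq (is_deriveD (is_derive_cst _ _ _) dl)).
  by rewrite add0r.
apply: derive_line; under eq_fun do rewrite residual_line.
exact: is_derive_score.
Qed.

End joint_density.

(** * Expected information and second moment of the score *)

Lemma Rintegral_sum {d} {T : measurableType d} {R : realType}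
    (mu : {measure set T -> \bar R}) (I : Type) (r : seq I) (f : I -> T -> R) :
  (forall i, mu.-integrable setT (EFin \o f i)) ->
  mu.-integrable setT (EFin \o (fun x => \sum_(i <- r) f i x)) /\
  \int[mu]_x (\sum_(i <- r) f i x) = \sum_(i <- r) \int[mu]_x f i x.
Proof.
move=> fi; elim: r => [|i r [IH1 IH2]].
  have -> : (fun x => \sum_(i <- [::]) f i x) = cst 0.
    by apply/funext => x; rewrite big_nil.
  by rewrite big_nil /Rintegral integral0; split=> //; exact: integrable0.
have -> : (fun x => \sum_(j <- i :: r) f j x) =
    (fun x => f i x + \sum_(j <- r) f j x).
  by apply/funext => x; rewrite big_cons.
by rewrite big_cons -IH2 -RintegralD//; split=> //; exact: integrable_EFinD.
Qed.

Section expectation_info.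
Context {d} {Omega : measurableType d} {R : realType}.
Variable P : probability Omega R.
Context {N L : nat}.
Let V := ('cV[R]_N * 'cV[R]_L)%type.
Variables s m a : R.
Hypotheses (s0 : 0 < s) (m0 : 0 < m) (a0 : 0 < a).
Variables (Z : {mfun Omega >-> V}) (C : R).
Hypothesis C0 : 0 <= C.
Hypothesis lawZ : forall A, measurable A -> P (Z @^-1` A) =
  (\int[lebesgue_vec R N \x lebesgue_vec R L]_(z in A)
     (C * expR (logdens s m a z))%:E)%E.

Lemma integrable_info (c c' : V) :
  P.-integrable setT (EFin \o (fun w => info s m a c c' (Z w))).
Proof.
apply: (@le_integrable_EFin _ _ _ _ _ (fun=> _)); last 2 first.
- by move=> w; exact: (info_bound s0 m0 a0 c c').
- exact: finite_measure_integrable_cst.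
- by apply: measurableT_comp => //; exact: measurable_info.
Qed.

(** All coordinates of [x] have the same mean curvature, so the Student part averages to a multiple
    of the dot product. *)
Lemma expectation_info (c c' : V) :
  \int[P]_w info s m a c c' (Z w) =
  dotv c.1 c'.1 / s + 2 * a * m * ((2 * a - 1) / (2 * a + 2)) * dotv c.2 c'.2.
Proof.
have icurv i : P.-integrable setT (EFin \o (fun w => student_curv m ((Z w).2 i ord0))).
  apply: (@le_integrable_EFin _ _ _ _ _ (fun=> 1)).
  - apply: (measurableT_comp (measurable_student_curv m0)).
    apply: (measurableT_comp (f := fun z : V => z.2 i ord0)) => //.
    exact: (measurableT_comp (measurable_entry i ord0) measurable_snd).
  - by move=> w; exact: student_curv_bound.
  - exact: finite_measure_integrable_cst.
pose f i w := c.2 i ord0 * (c'.2 i ord0 * student_curv m ((Z w).2 i ord0)).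
have ifi i : P.-integrable setT (EFin \o f i) by do 2 apply: integrable_EFinZ.
have [iS ES] := Rintegral_sum (index_enum 'I_L) ifi.
rewrite [LHS](_ : _ = \int[P]_w (dotv c.1 c'.1 / s) +
    2 * a * m * \int[P]_w (\sum_i f i w)); last first.
  rewrite -RintegralZl// -RintegralD//; last exact: integrable_EFinZ.
  exact: finite_measure_integrable_cst.
rewrite ES Rintegral_cst// [fine _](congr1 fine (probability_setT P)) mulr1.
congr (_ + _); rewrite -[RHS]mulrA; congr (_ * _).
rewrite /dotv mulr_sumr; apply: eq_bigr => i _.
rewrite /f !RintegralZl//; last exact: integrable_EFinZ.
by rewrite (expectation_curv s0 m0 a0 C0 lawZ); ring.
Qed.

(** The majorant [g] of the score satisfies [g <= exp g], hence [g^2 <= exp (2 g)]. *)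
Lemma integrable_score_sqr (c : V) :
  P.-integrable setT (EFin \o (fun w => score s m a c (Z w) ^+ 2)).
Proof.
apply: le_integrable_EFin (integrable_expR_growth s0 C0 lawZ c (ler0n R 2)).
  by apply: measurable_funX; apply: measurableT_comp => //; exact: measurable_score.
move=> w; rewrite normrX mulr2n mulrDl mul1r expRD expr2.
have := score_growth s0 m0 a0 c (Z w); set g := growth _ _ _ _ _ => Sg.
have geg : g <= expR g by rewrite (le_trans _ (expR_ge1Dx g))// lerDr.
by rewrite ler_pM// (le_trans Sg).
Qed.

(** The two forms of the Fisher information agree: take the score itself as test function, with
    derivative [- info] along [c]. *)
Lemma expectation_score_sqr (c : V) :
  \int[P]_w (score s m a c (Z w) * score s m a c (Z w)) =
  \int[P]_w info s m a c c (Z w).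
Proof.
rewrite (stein s0 m0 a0 C0 lawZ (measurable_score s a m0 c)
  (measurable_funN (measurable_info s a m0 c c)) (integrable_score_sqr c)
  (fun z => is_derive_score s a m0 c c z) (score_lipschitz s0 m0 a0 c c)).
  rewrite -mulN1r -RintegralZl//; last first.
    have := integrable_EFinZ (-1) (integrable_info c c).
    by under eq_fun do rewrite mulN1r.
  by apply: eq_Rintegral => w _; rewrite mulN1r opprK.
by move=> z; rewrite normrN; exact: info_bound.
Qed.

End expectation_info.

(** * The bilinear form of the information matrix *)

Section information_form.
Context {R : realType} {N L : nat}.
Variables (Phi : 'M[R]_(N, L)) (t k : R).
Let M : 'M[R]_L := t *: (Phi^T *m Phi) + k%:M.

Lemma information_form_bilinear (b c : 'cV[R]_L) :
  dotv b (M *m c) = t * dotv (Phi *m b) (Phi *m c) + k * dotv b c.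
Proof.
rewrite mulmxDl dotvDr -scalemxAl dotvZr mul_scalar_mx dotvZr.
by rewrite !dotvE trmx_mul !mulmxA.
Qed.

Lemma information_form_tr : M^T = M.
Proof. by rewrite linearD/= linearZ/= trmx_mul trmxK tr_scalar_mx. Qed.

(** A kernel vector [u] makes [t |Phi u|^2 + k |u|^2] vanish; both terms are nonnegative and
    [k > 0], so [u = 0]. *)
Lemma information_form_unit : 0 <= t -> 0 < k -> M \in unitmx.
Proof.
move=> t0 k0; rewrite -row_free_unit; apply: inj_row_free => u uM.
apply: trmx_inj; rewrite trmx0; apply: dotv_eq0; apply/eqP.
have : dotv u^T (M *m u^T) = 0.
  by rewrite -information_form_tr -trmx_mul uM trmx0 dotvE mulmx0 mxE.
rewrite information_form_bilinear => /eqP.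
have p0 := dotv_ge0 (Phi *m u^T); have u0 := dotv_ge0 u^T.
rewrite paddr_eq0 ?mulr_ge0//; last exact: ltW.
by move=> /andP[_]; rewrite mulf_eq0 gt_eqF.
Qed.

End information_form.

(** * The mean-square error and the van Trees inequality *)

Lemma mse_matrix_quadratic {d} {Omega : measurableType d} {R : realType}
    (P : probability Omega R) (N L : nat) (x : {RV P >-> 'cV[R]_L})
    (y : {RV P >-> 'cV[R]_N}) (xhat : {mfun 'cV[R]_N >-> 'cV[R]_L})
    (v : 'cV[R]_L) : mse_exists xhat y x ->
  let f w := dotv v (estimation_error xhat y x w) in
  P.-integrable setT (EFin \o (fun w => f w ^+ 2)) /\
  (v^T *m mse_matrix xhat y x *m v) ord0 ord0 = \int[P]_w (f w ^+ 2).
Proof.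
move=> mse f.
pose e w := estimation_error xhat y x w.
(* The square of [v . e] is the double sum of these terms, so entrywise integrability carries over
   to it. *)
pose g j i w := v i ord0 * v j ord0 * (e w *m (e w)^T) i j.
have ig j i : P.-integrable setT (EFin \o g j i).
  by apply: integrable_EFinZ; exact: mse.
have S1 j := Rintegral_sum (index_enum 'I_L) (ig j).
have [S2i S2] := Rintegral_sum (index_enum 'I_L) (fun j => (S1 j).1).
have fE : (fun w => f w ^+ 2) = (fun w => \sum_j \sum_i g j i w).
  apply/funext => w; rewrite /f /dotv expr2 mulr_sumr; apply: eq_bigr => j _.
  rewrite mulr_suml; apply: eq_bigr => i _.
  rewrite /g -/(e w).
  have -> : (e w *m (e w)^T) i j = e w i ord0 * e w j ord0.
    by rewrite mxE big_ord1 [_^T _ _]mxE.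
  by ring.
rewrite fE; split=> //; rewrite S2 mxE; apply: eq_bigr => j _.
rewrite (S1 j).2 mxE mulr_suml; apply: eq_bigr => i _.
rewrite /g RintegralZl ?(mse i j)// [v^T _ _]mxE [mse_matrix _ _ _ _ _]mxE unlock.
exact: mulrAC.
Qed.

Theorem theorem2 (d : measure_display) (Omega : measurableType d)
    (R : realType) (P : probability Omega R) (N L : nat)
    (Phi : 'M[R]_(N, L)) (sigma2 nu lambda : R)
    (x : {RV P >-> 'cV[R]_L}) (n y : {RV P >-> 'cV[R]_N})
    (N_ge1 : (1 <= N)%N) (L_ge1 : (1 <= L)%N)
    (sigma2_gt0 : 0 < sigma2) (nu_gt0 : 0 < nu) (lambda_gt0 : 0 < lambda)
    (x_density : has_density x (student_pdf nu lambda))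
    (n_density : has_density n (mvnormal_pdf 0 (sigma2%:M)))
    (n_indep_x : independent_rv n x)
    (y_model : forall w, y w = Phi *m x w + n w) :
  let M := information_matrix (joint_pdf Phi sigma2 nu lambda) y x in
  M = sigma2^-1 *: (Phi^T *m Phi) + (lambda * (nu + 1) / (nu + 3))%:M /\
  forall xhat : {mfun 'cV[R]_N >-> 'cV[R]_L},
    mse_exists xhat y x -> loewner_ge (mse_matrix xhat y x) (invmx M).
Proof.
pose m := lambda / nu; pose a := (nu + 1) / 2.
have m0 : 0 < m by rewrite divr_gt0.
have a0 : 0 < a by rewrite divr_gt0// addr_gt0.
pose C := @joint_const R N L sigma2 nu lambda.
have C0 : 0 <= C by exact: joint_const_ge0.
pose nx w := (n w, x w).
have mnx : measurable_fun setT nx by apply/measurable_fun_pair.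
pose nxM := isMeasurableFun.Build _ _ _ _ nx mnx.
pose Z : {mfun Omega >-> ('cV[R]_N * 'cV[R]_L)%type} := HB.pack nx nxM.
have lawZ A : measurable A -> P (Z @^-1` A) =
    (\int[lebesgue_vec R N \x lebesgue_vec R L]_(z in A)
      (C * expR (logdens sigma2 m a z))%:E)%E.
  (* With the zero matrix in place of [Phi], the observation of the additive noise model is [n]
     itself, which yields the law of [(n, x)]. *)
  move=> mA; have nE w : n w = 0 *m x w + n w by rewrite mul0mx add0r.
  rewrite [LHS](additive_noise_density (@measurable_student_pdf _ _ nu lambda)
    (@measurable_mvnormal_pdf _ _ _ _) (student_pdf_ge0 nu lambda)
    (@mvnormal_pdf_ge0 _ _ _ _) x_density n_density n_indep_x nE mA).
  apply: eq_integral => -[u v] _.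
  by rewrite /= mul0mx subr0 density_logdens.
(* If [C] vanished, [Z] would have total mass 0 instead of 1; this bypasses the Gamma integrals. *)
have C_gt0 : 0 < C.
  rewrite lt_def C0 andbT; apply/eqP => CE.
  have := lawZ _ measurableT; rewrite preimage_setT CE.
  under eq_integral do rewrite mul0r.
  rewrite integral0 => P0; have := probability_setT P; rewrite P0 => /eqP.
  by rewrite lt_eqF.
have residual w : (y w - Phi *m x w, x w) = Z w.
  by rewrite /Z /= /nx y_model addrC addKr.
move=> M.
pose k := lambda * (nu + 1) / (nu + 3).
have k0 : 0 < k by rewrite divr_gt0 ?mulr_gt0 ?addr_gt0.
(* Here [2 a = nu + 1], so the mean curvature is [nu / (nu + 3)], and its [nu] cancels the
   denominator of [m]. *)
have kE : 2 * a * m * ((2 * a - 1) / (2 * a + 2)) = k.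
  by rewrite /a /m /k; field; rewrite !gt_eqF ?addr_gt0.
have ME : M = sigma2^-1 *: (Phi^T *m Phi) + k%:M.
  apply/matrixP => i j.
  pose ci := data_direction Phi (delta_mx i ord0).
  pose cj := data_direction Phi (delta_mx j ord0).
  (* The minus signs of the information matrix and of the Hessian formula cancel. The inner
     derivative is along axis [j], whence the order [cj], [ci]. *)
  transitivity (\int[P]_w info sigma2 m a cj ci (Z w)).
    rewrite mxE mxE unlock -[RHS]opprK; congr (- _).
    rewrite -mulN1r -RintegralZl//; last exact: integrable_info.
    congr fine; apply: eq_integral => w _; congr EFin.
    by rewrite hessian_joint_pdf// residual mulN1r.
  rewrite (expectation_info sigma2_gt0 m0 a0 C0 lawZ) kE /ci /cj /=.
  rewrite dotvNl dotvNr opprK dotvC [dotv (delta_mx j _) _]dotvC mulrC.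
  by rewrite -information_form_bilinear dotv_delta -colE mxE.
split=> // xhat mse.
have Mu : M \in unitmx by rewrite ME information_form_unit// invr_ge0 ltW.
have Mt : M^T = M by rewrite ME information_form_tr.
split.
  rewrite linearB/= trmx_inv Mt; congr (_ - _); apply/matrixP => i j.
  rewrite !mxE; congr fine; congr expectation; apply/funext => w.
  rewrite /=; set e := estimation_error _ _ _ _.
  have eT : (e *m e^T)^T = e *m e^T by rewrite trmx_mul trmxK.
  by rewrite -[in RHS]eT [RHS]mxE.
(* This [b] makes [b^T M b] equal to [v . b = v^T M^-1 v], the very term subtracted from the
   mean-square error. *)
move=> v; pose b := invmx M *m v; pose c := data_direction Phi b.
have [if2 Ef2] := mse_matrix_quadratic v mse.
rewrite mulmxBr mulmxBl mxE [X in _ + X]mxE Ef2 -mulmxA -dotvE -/b.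
pose F (z : 'cV[R]_N * 'cV[R]_L) := dotv v (z.2 - xhat (z.1 + Phi *m z.2)).
have FZ w : F (Z w) = dotv v (estimation_error xhat y x w).
  by rewrite /F /= /estimation_error y_model [Phi *m _ + _]addrC.
have mF : measurable_fun setT F.
  have mobs : measurable_fun setT
      (fun z : 'cV[R]_N * 'cV[R]_L => z.1 + Phi *m z.2).
    apply/measurable_fun_entryP => i j; under eq_fun do rewrite mxE.
    apply: measurable_funD.
      exact: (measurableT_comp (measurable_entry i j) measurable_fst).
    apply: (measurableT_comp (measurable_entry i j)).
    exact: (measurableT_comp (measurable_mulmxl Phi) measurable_snd).
  apply: (measurableT_comp (measurable_dotv v)).
  apply/measurable_fun_entryP => i j; under eq_fun do rewrite 2!mxE.
  apply: measurable_funB.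
    exact: (measurableT_comp (measurable_entry i j) measurable_snd).
  apply: (measurableT_comp (measurable_entry i j)).
  exact: (measurableT_comp _ mobs).
have F2 : P.-integrable setT (EFin \o (fun w => F (Z w) ^+ 2)).
  by under eq_fun do rewrite FZ.
(* Moving along [c] leaves the observation [z.1 + Phi z.2] fixed, so [xhat] does not vary and [F] is
   affine there, for an arbitrary measurable estimator. *)
have Fline z (h : R) : F (z + h *: c) = F z + h * dotv v b.
  rewrite /F /= mulmxDr -scalemxAr scalerN addrACA addNr addr0.
  by rewrite -dotvZr -dotvDr addrAC.
have dF z : is_derive (0 : R) 1 (fun h : R => F (z + h *: c)) (dotv v b).
  under eq_fun do rewrite Fline.
  exact: is_derive_affine.
have Fl z (h : R) : `|F (z + h *: c) - F z| <= `|h| * `|dotv v b|.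
  by rewrite Fline addrC addKr normrM.
have FS := stein sigma2_gt0 m0 a0 C0 lawZ mF (measurable_cst (dotv v b)) F2 dF Fl
  (fun=> lexx _).
have iFS := integrable_stein sigma2_gt0 m0 a0 C0 lawZ mF
  (measurable_cst (dotv v b)) F2 dF Fl (fun=> lexx _).
have SS := expectation_score_sqr sigma2_gt0 m0 a0 C0 lawZ c.
have iSS := integrable_score_sqr sigma2_gt0 m0 a0 C0 lawZ c.
(* The second moment of the score along [c] becomes [b . (M b)], then [v . b] by the choice of
   [b]. *)
rewrite (expectation_info sigma2_gt0 m0 a0 C0 lawZ) kE /c /= in SS.
rewrite dotvNl dotvNr opprK mulrC -information_form_bilinear -ME /b in SS.
rewrite mulmxA mulmxV// mul1mx -/b dotvC in SS.
rewrite Rintegral_cst// [fine _](congr1 fine (probability_setT P)) mulr1 in FS.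
set S := fun w => score sigma2 m a c (Z w).
(* Since [E[F S] = - v . b] and [E[S^2] = v . b], the sum [2 E[F S] + E[S^2]] equals [- v . b],
   which completes the square. *)
have -> : \int[P]_w (dotv v (estimation_error xhat y x w) ^+ 2) - dotv v b =
    \int[P]_w ((F (Z w) + S w) ^+ 2).
  transitivity (\int[P]_w (F (Z w) ^+ 2) + 2 * \int[P]_w (F (Z w) * S w) +
      \int[P]_w (S w ^+ 2)).
    have -> : \int[P]_w (S w ^+ 2) = dotv v b by exact: SS.
    rewrite FS.
    have -> : \int[P]_w (F (Z w) ^+ 2) =
        \int[P]_w (dotv v (estimation_error xhat y x w) ^+ 2).
      by apply: eq_Rintegral => w _; rewrite FZ.
    by ring.
  have i2FS := integrable_EFinZ 2 iFS.
  rewrite -RintegralZl// -!RintegralD//; last exact: integrable_EFinD.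
  by apply: eq_Rintegral => w _; ring.
by apply: Rintegral_ge0 => w _; exact: sqr_ge0.
Qed.
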